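(* Assume that $\mathcal I$ is a building. Let $\theta\in\Theta_+$. Then the distances $d_{\mathcal I}$ and $d_\theta$ on $\mathcal I$ are equivalent, i.e. there exist $k,\ell\in\mathbb R_{>0}$ such that $k\,d_{\mathcal I}\le d_\theta\le\ell\,d_{\mathcal I}$.
   Context: **Vectorial data.** $I$ is a finite set and $C=(c_{i,j})_{i,j\in I}$ is a Kac--Moody matrix: $c_{i,j}\in\mathbb Z$, $c_{i,i}=2$, $c_{i,j}\le 0$ for $i\neq j$, and $c_{i,j}=0\iff c_{j,i}=0$. $X,Y$ are dual free $\mathbb Z$-modules of finite rank with $\mathbb Z$-linearly independent families $(\alpha_i)_{i\in I}$ in $X$ and $(\alpha_i^\vee)_{i\in I}$ in $Y$ such that $\alpha_j(\alpha_i^\vee)=c_{i,j}$. $\mathbb A=Y\otimes\mathbb R$, with its usual topology; elements of $X$ are linear forms on $\mathbb A$. $r_i(v)=v-\alpha_i(v)\alpha_i^\vee$, and $W^v=\langle r_i\mid i\in I\rangle\subset \mathrm{GL}(\mathbb A)$ (Weyl group), acting on $\mathbb A^*$ by $(w.\alpha)(x)=\alpha(w^{-1}x)$. $\Phi=\{w.\alpha_i\}$ is the set of real roots; for $\alpha=w.\alpha_i\in\Phi$, $\alpha^\vee=w.\alpha_i^\vee$. $Q^\vee=\bigoplus_i\mathbb Z\alpha_i^\vee$ and $W^a=Q^\vee\rtimes W^v$. $\Delta\subset\bigoplus_i\mathbb Z\alpha_i\subset\mathbb A^*$ is the set of all (real and imaginary) roots of the Kac--Moody algebra of $C$. For $\alpha\in\mathbb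 A^*$, $k\in\mathbb R$: $D(\alpha,k)=\{\alpha(x)+k\ge0\}$, $D^\circ(\alpha,k)=\{\alpha(x)+k>0\}$, $M(\alpha,k)=\{\alpha(x)+k=0\}$, and $D(\alpha,+\infty)=D^\circ(\alpha,+\infty)=\mathbb A$. Walls (resp. half-apartments) are the $M(\alpha,k)$ (resp. $D(\alpha,k)$), $\alpha\in\Phi$, $k\in\mathbb Z$. $C^v_f=\{v\mid\alpha_i(v)>0\ \forall i\}$; for $J\subset I$, $F^v(J)=\{v\mid \alpha_i(v)=0\ (i\in J),\ \alpha_i(v)>0\ (i\notin J)\}$. Positive (resp. negative) vectorial faces are the $w.F^v(J)$ (resp. $-w.F^v(J)$), $w\in W^v$; vectorial chambers are the $\pm w.C^v_f$. Tits cone: $\mathcal T=\bigcup_{w}w.\overline{C^v_f}$. A vectorial face is spherical if it meets $\pm\mathring{\mathcal T}$. $x\le y$ means $y-x\in\mathcal T$. A ray or segment through $x\ne y$ from $x$ is preordered if $x\le y$ or $y\le x$, generic if $y-x\in\pm\mathring{\mathcal T}$. **Filters.** A filter lies in a set $Z$ if $Z$ is an element of it; a set (e.g. an apartment) contains a filter if it contains an element of it; a map fixes a filter if it fixes pointwise some element of it. The support of a filter is the smallest affine subspace containing it. $\mathcal F\Cup\mathcal F'=\{E\cup E'\mid E\in\mathcal F,E'\in\mathcal F'\}$. The enclosure $\mathrm{cl}(\mathcal F)$ of a filter on $\mathbb A$ is the filter of sets $E$ containing some $\bigcap_{\alpha\in\Delta}D(\alpha,k_\alpha)\in\mathcal F$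 with $k_\alpha\in\mathbb Z\cup\{+\infty\}$ (a set is treated as its principal filter). A sector-face is $f=x+F^v$ ($F^v$ a vectorial face); its germ at infinity is the filter of sets containing $x+u+F^v$ for some $u\in\overline{F^v}$. If $F^v$ is a vectorial chamber, $f$ is a sector and its germ is a sector-germ, with the sign of $F^v$; $\pm\infty$ is the germ of $\pm C^v_f$. The face $F(x,F^v)$ is the filter of sets $E$ for which there are $k_\alpha,k'_\alpha\in\mathbb Z\cup\{+\infty\}$ $(\alpha\in\Delta)$ and a neighbourhood $\Omega$ of $x$ with $E\supset\bigcap_{\alpha}(D(\alpha,k_\alpha)\cap D^\circ(\alpha,k'_\alpha))\supset\Omega\cap(x+F^v)$. A chamber (resp. panel) is a face with support $\mathbb A$ (resp. a wall). A chimney is $\mathfrak r(F,F^v)=\mathrm{cl}(F+F^v)$, $F$ a face, $F^v$ a vectorial face; it is splayed if $F^v$ is spherical, solid if the pointwise stabilizer in $W^v$ of the direction of its support is finite. Its germ is the filter of sets belonging to some $\mathfrak r(F+u,F^v)$, $u\in\overline{F^v}$. **Apartments.** $\mathrm{Aut}(\mathbb A)$ is the group of affine bijections of $\mathbb A$ stabilizing $\{(M(\alpha,k),\alpha^\vee)\mid\alpha\in\Phi,k\in\mathbb Z\}$. An apartment of type $\mathbb A$ is a set $A$ with a nonempty set $\mathrm{Isom}^w(\mathbb A,A)$ of bijections $\mathbb A\to A$ forming one orbit $f_0\circ W^a$. A bijection $\phi:A\to A'$ is a Weyl isomorphism (resp. an isomorphism, which here always means vectorially Weyl isomorphism) if $f'^{-1}\circ\phi\circ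 f\in W^a$ (resp. $\in(W^v\ltimes\mathbb A)\cap\mathrm{Aut}(\mathbb A)$) for $f\in\mathrm{Isom}^w(\mathbb A,A)$, $f'\in\mathrm{Isom}^w(\mathbb A,A')$. All above notions, the affine structure and the affine topology are transported to every apartment. **Masure.** A masure of type $\mathbb A$ is a set $\mathcal I$ covered by a family of subsets called apartments such that: (MA1) each apartment has a structure of apartment of type $\mathbb A$. (MA2) If $F$ is a point, a germ of a preordered interval, a generic ray or a solid chimney in an apartment $A$, and $A'$ is another apartment containing $F$, then $A\cap A'$ contains $\mathrm{cl}_A(F)$ and there is a Weyl isomorphism $A\to A'$ fixing $\mathrm{cl}_A(F)$. (MA3) If $\mathfrak R$ is the germ of a splayed chimney and $F$ is a face or a germ of a solid chimney, some apartment contains $\mathfrak R$ and $F$. (MA4) If apartments $A,A'$ contain $\mathfrak R$ and $F$ as in (MA3), there is a Weyl isomorphism $A\to A'$ fixing $\mathrm{cl}_A(\mathfrak R\Cup F)$. (MAO) If $x,y\in A\cap A'$ and $x\le_A y$ then $[x,y]_A=[x,y]_{A'}$. Standing assumptions: $\mathcal I$ is such a masure; each panel lies in the closure of finitely many, and more than $2$, chambers; a group $G$ acts strongly transitively on $\mathcal I$ (it permutes apartments, each $g:A\to g.A$ is an isomorphism of apartments, and all isomorphisms in the axioms are induced by elements of $G$); $\mathbb A$ is identified with a fixed apartment of $\mathcal I$, and the stabilizer of $\mathbb A$ in $G$ induces on $\mathbb A$ the group $W^v\ltimes Y$. $\mathcal I$ is a building if and only if $W^v$ is finite. Sector-germs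 of $\mathcal I$ are sector-germs of its apartments (a sector-germ contained in an apartment $B$ is a sector-germ of $B$, of the same sign). **Distances.** Let $\mathfrak s$ be a sector-germ of sign $\mathrm{sgn}(\mathfrak s)\in\{+,-\}$, $x\in\mathcal I$, $u\in\overline{C^v_f}$. Choose an apartment $A_1$ containing $x$ and $\mathfrak s$ and an isomorphism $\psi:\mathbb A\to A_1$ with $\psi(\mathrm{sgn}(\mathfrak s)\infty)=\mathfrak s$; then $x+_{\mathfrak s}u:=\psi(\psi^{-1}(x)+\mathrm{sgn}(\mathfrak s)u)$ is independent of choices. $U_{\mathfrak s}(x,x')=\{(u,u')\in\overline{C^v_f}^2\mid x+_{\mathfrak s}u=x'+_{\mathfrak s}u'\}$, which is nonempty. $\Theta_+$ (resp. $\Theta_-$) is the set of pairs $\theta=(|\cdot|,\mathfrak s)$ with $|\cdot|$ a norm on $\mathbb A$ and $\mathfrak s$ a positive (resp. negative) sector-germ of $\mathcal I$. For such $\theta$, $d_\theta(x,x')=\inf\{|u|+|u'|\mid(u,u')\in U_{\mathfrak s}(x,x')\}$ is a distance on $\mathcal I$. **Usual distance on a building.** When $\mathcal I$ is a building, fix a $W^v$-invariant Euclidean norm on $\mathbb A$ and let $d_{\mathbb A}$ be the induced distance. Any $x,x'\in\mathcal I$ lie in a common apartment $A$; for an isomorphism of apartments $f:A\to\mathbb A$ put $d_{\mathcal I}(x,x')=d_{\mathbb A}(f(x),f(x'))$. This is well defined and is a distance on $\mathcal I$. *)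

(* Defs.v *)
From HB Require Import structures.
From mathcomp Require Import all_boot all_order all_algebra.
From mathcomp Require Import all_classical all_reals all_analysis.
From mathcomp.real_closed Require Export complex.

Set Implicit Arguments.
Unset Strict Implicit.
Unset Printing Implicit Defensive.

Import Order.TTheory GRing.Theory Num.Theory.
Import numFieldNormedType.Exports.

Local Open Scope classical_set_scope.
Local Open Scope ring_scope.

Record kac_moody_matrix (I : finType) (C : I -> I -> int) : Prop := {
  kmm_diag : forall i, C i i = 2 ;
  kmm_off : forall i j, i != j -> C i j <= 0 ;
  kmm_zero : forall i j, C i j = 0 <-> C j i = 0 }.

(** Bases are chosen: [Y] is Z^n and [X], its dual, is Z^n acting on [Y] by the
    standard pairing. *)
Record vectorial_data := VectorialData {
  vd_I : finType ;
  vd_rank : nat ;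
  vd_C : vd_I -> vd_I -> int ;
  vd_alpha : vd_I -> 'rV[int]_vd_rank ;
  vd_coalpha : vd_I -> 'rV[int]_vd_rank ;
  vd_kmm : kac_moody_matrix vd_C ;
  vd_alpha_free : forall c : vd_I -> int,
    \sum_i vd_alpha i *~ c i = 0 -> forall i, c i = 0 ;
  vd_coalpha_free : forall c : vd_I -> int,
    \sum_i vd_coalpha i *~ c i = 0 -> forall i, c i = 0 ;
  vd_pairing : forall i j,
    \sum_k vd_alpha j 0 k * vd_coalpha i 0 k = vd_C i j }.

Definition kmm_rank (I : finType) (C : I -> I -> int) : nat :=
  \rank (\matrix_(i < #|I|, j < #|I|) (C (enum_val i) (enum_val j))%:~R
           : 'M[rat]_#|I|).

(** A complex Lie algebra [g] which is the Kac-Moody algebra g(C), in the sense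
    of Kac: it is generated by a Cartan subalgebra, given by a minimal
    realization [(h, a, a^vee)] of C (dim h = 2 |I| - rank C), and by Chevalley
    generators, and no nonzero ideal of it meets [h] trivially.  These data
    determine [g] up to isomorphism.  The space [h] is put in coordinates and
    [kma_h] is its embedding in [g]; [(h *m kma_root i) 0 0] is a_i(h). *)
Record kac_moody_algebra (K : fieldType) (I : finType) (C : I -> I -> int) :=
  KacMoodyAlgebra {
  kma_car : lmodType K ;
  kma_br : kma_car -> kma_car -> kma_car ;
  kma_br_linl : forall (c : K) x y z,
    kma_br (c *: x + y) z = c *: kma_br x z + kma_br y z ;
  kma_br_linr : forall (c : K) x y z,
    kma_br z (c *: x + y) = c *: kma_br z x + kma_br z y ;
  kma_br_alt : forall x, kma_br x x = 0 ;
  kma_jacobi : forall x y z,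
    kma_br x (kma_br y z) + kma_br y (kma_br z x) + kma_br z (kma_br x y) = 0 ;
  kma_root : I -> 'cV[K]_(2 * #|I| - kmm_rank C) ;
  kma_coroot : I -> 'rV[K]_(2 * #|I| - kmm_rank C) ;
  kma_root_free : forall c : I -> K,
    \sum_i c i *: kma_root i = 0 -> forall i, c i = 0 ;
  kma_coroot_free : forall c : I -> K,
    \sum_i c i *: kma_coroot i = 0 -> forall i, c i = 0 ;
  kma_pairing : forall i j,
    (kma_coroot i *m kma_root j) 0 0 = (C i j)%:~R ;
  kma_h : {linear 'rV[K]_(2 * #|I| - kmm_rank C) -> kma_car} ;
  kma_h_inj : injective kma_h ;
  kma_e : I -> kma_car ;
  kma_f : I -> kma_car ;
  kma_hh : forall h h', kma_br (kma_h h) (kma_h h') = 0 ;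
  kma_he : forall h i,
    kma_br (kma_h h) (kma_e i) = (h *m kma_root i) 0 0 *: kma_e i ;
  kma_hf : forall h i,
    kma_br (kma_h h) (kma_f i) = - ((h *m kma_root i) 0 0 *: kma_f i) ;
  kma_ef : forall i j,
    kma_br (kma_e i) (kma_f j) = if i == j then kma_h (kma_coroot i) else 0 ;
  kma_generated : forall S : set kma_car,
    (forall h, S (kma_h h)) -> (forall i, S (kma_e i)) ->
    (forall i, S (kma_f i)) ->
    (forall (c : K) x y, S x -> S y -> S (c *: x + y)) ->
    (forall x y, S x -> S y -> S (kma_br x y)) ->
    forall x, S x ;
  kma_no_ideal : forall J : set kma_car,
    J 0 -> (forall (c : K) x y, J x -> J y -> J (c *: x + y)) ->
    (forall x y, J y -> J (kma_br x y)) ->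
    (forall h, J (kma_h h) -> h = 0) ->
    forall x, J x -> x = 0 }.

(** The roots, real and imaginary; [n] stands for \sum_i n_i alpha_i. *)
Definition km_roots (K : fieldType) (I : finType) (C : I -> I -> int)
    (g : kac_moody_algebra K C) : set {ffun I -> int} :=
  [set n | n != 0 /\ exists x : kma_car g, x != 0 /\
     forall h, kma_br (kma_h g h) x =
       (h *m (\sum_i kma_root g i *~ n i)) 0 0 *: x].

(** The model apartment Y (x) R. *)
Notation AA R V := 'rV[R]_(vd_rank V).

Section Apartment.
Variables (R : realType) (V : vectorial_data).

Local Notation I := (vd_I V).

Local Notation AA := (AA R V).

Definition form (a : 'rV[int]_(vd_rank V)) (v : AA) : R :=
  \sum_k (a 0 k)%:~R * v 0 k.

Definition simple_root (i : I) : AA -> R := form (vd_alpha i).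

Definition intvec (y : 'rV[int]_(vd_rank V)) : AA := map_mx intr y.

Definition simple_coroot (i : I) : AA := intvec (vd_coalpha i).

Definition refl (i : I) (v : AA) : AA := v - simple_root i v *: simple_coroot i.

(** The subgroup generated by the [refl i], which are involutions. *)
Inductive Wv : set (AA -> AA) :=
| Wv_id : Wv id
| Wv_refl i w : Wv w -> Wv (refl i \o w).

(** The pairs (alpha, alpha^vee) for alpha = w.alpha_i a real root; the
    equation alpha \o w = alpha_i says that alpha = alpha_i \o w^-1. *)
Definition real_roots : set ((AA -> R) * AA) :=
  [set p : (AA -> R) * AA | exists w i, [/\ Wv w, p.1 \o w = simple_root i
                         & p.2 = w (simple_coroot i)]].

(** [aff_group Q] is the semidirect product of Q by W^v, for Q a W^v-stable
    additive subgroup of the apartment. *)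
Definition aff_group (Q : set AA) : set (AA -> AA) :=
  [set phi | exists w q, [/\ Wv w, Q q & phi = (fun x => w x + q)]].

Definition coroot_lattice : set AA :=
  [set \sum_i simple_coroot i *~ n i | n in [set: I -> int]].

Definition Wa : set (AA -> AA) := aff_group coroot_lattice.
Definition WvY : set (AA -> AA) := aff_group (range intvec).
Definition WvA : set (AA -> AA) := aff_group setT.

(** Elements of Z u {+oo} have type [option int], [None] being +oo. *)
Definition halfspace (a : AA -> R) (k : option int) : set AA :=
  if k is Some k then [set x | 0 <= a x + k%:~R] else setT.

Definition ohalfspace (a : AA -> R) (k : option int) : set AA :=
  if k is Some k then [set x | 0 < a x + k%:~R] else setT.

Definition hyper (a : AA -> R) (k : int) : set AA := [set x | a x + k%:~R = 0].

(** The pairs (M(alpha, k), alpha^vee). *)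
Definition walls : set (set AA * AA) :=
  [set q | exists p k, real_roots p /\ q = (hyper p.1 k, p.2)].

Definition affine_bij (phi : AA -> AA) : Prop :=
  bijective phi /\
  exists (L : {linear AA -> AA}) (t : AA), phi = (fun x => L x + t).

(** [phi v - phi 0] is the image of the vector v by the linear part of phi. *)
Definition AutA : set (AA -> AA) :=
  [set phi | affine_bij phi /\
     [set (phi @` q.1, phi q.2 - phi 0) | q in walls] = walls].

(** Signs are booleans, [true] being +. *)
Definition sg (eps : bool) (v : AA) : AA := if eps then v else - v.

Definition Cvf : set AA := [set v | forall i, 0 < simple_root i v].

Definition Fv0 (J : {set I}) : set AA :=
  [set v | forall i, if i \in J then simple_root i v = 0
                     else 0 < simple_root i v].

Definition vface_of_sign (eps : bool) : set (set AA) :=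
  [set F | exists w J, Wv w /\ F = (sg eps \o w) @` Fv0 J].

Definition vface : set (set AA) := [set F | exists eps, vface_of_sign eps F].

Definition vchamber_of_sign (eps : bool) : set (set AA) :=
  [set F | exists w, Wv w /\ F = (sg eps \o w) @` Cvf].

Definition tits : set AA :=
  [set v | exists w, Wv w /\ (w @` closure Cvf) v].

(** The union of the interiors of the Tits cone and of its opposite. *)
Definition generic : set AA := [set v | interior tits v \/ interior tits (- v)].

Definition spherical (F : set AA) : Prop := F `&` generic !=set0.

Definition leA (x y : AA) : Prop := tits (y - x).

Definition segment (x y : AA) : set AA :=
  [set x + t *: (y - x) | t in [set t : R | 0 <= t <= 1]].

Definition lopen_segment (x y : AA) : set AA :=
  [set x + t *: (y - x) | t in [set t : R | 0 < t <= 1]].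

Definition ray (x y : AA) : set AA :=
  [set x + t *: (y - x) | t in [set t : R | 0 <= t]].

Definition affine_subspace (S : set AA) : Prop :=
  exists (x : AA) (U : {vspace AA}), S = [set x + v | v in [set v | v \in U]].

Definition support (F : set_system AA) : set AA :=
  \bigcap_(S in [set S | affine_subspace S /\ F S]) S.

Definition direction (S : set AA) : set AA :=
  [set v | exists x y, [/\ S x, S y & v = y - x]].

Definition translate (u : AA) (F : set_system AA) : set_system AA :=
  fmap (fun x => x + u) F.

Definition add_filter (F : set_system AA) (S : set AA) : set_system AA :=
  [set E | exists2 E1, F E1 & [set x + v | x in E1 & v in S] `<=` E].

(** The germ at infinity of the sector-face x + F. *)
Definition sface_germ (x : AA) (F : set AA) : set_system AA :=
  [set E | exists2 u, closure F u & [set x + u + v | v in F] `<=` E].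

Variable g : kac_moody_algebra R[i] (@vd_C V).

Definition Delta : set {ffun I -> int} := km_roots g.

Definition Qform (n : {ffun I -> int}) (v : AA) : R :=
  \sum_i (n i)%:~R * simple_root i v.

Definition encl (F : set_system AA) : set_system AA :=
  [set E | exists k : {ffun I -> int} -> option int,
     let P := \bigcap_(n in Delta) halfspace (Qform n) (k n) in
     F P /\ P `<=` E].

Definition lface (x : AA) (Fv : set AA) : set_system AA :=
  [set E | exists (k k' : {ffun I -> int} -> option int) (Om : set AA),
     let P := \bigcap_(n in Delta)
                (halfspace (Qform n) (k n) `&` ohalfspace (Qform n) (k' n)) in
     [/\ nbhs x Om, P `<=` E & Om `&` [set x + v | v in Fv] `<=` P]].

Definition is_face (F : set_system AA) : Prop :=
  exists x Fv, vface Fv /\ F = lface x Fv.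

Definition is_chamber (F : set_system AA) : Prop :=
  is_face F /\ support F = setT.

Definition is_panel (F : set_system AA) : Prop :=
  is_face F /\ exists2 q, walls q & support F = q.1.

Definition chimney (F : set_system AA) (Fv : set AA) : set_system AA :=
  encl (add_filter F Fv).

Definition solid (F : set_system AA) (Fv : set AA) : Prop :=
  finite_set [set w | Wv w /\
    forall v, direction (support (chimney F Fv)) v -> w v = v].

Definition chimney_germ (F : set_system AA) (Fv : set AA) : set_system AA :=
  [set E | exists2 u, closure Fv u & chimney (translate u F) Fv E].

Definition solid_chimney (F : set_system AA) : Prop :=
  exists F0 Fv, [/\ is_face F0, vface Fv, solid F0 Fv & F = chimney F0 Fv].

Definition solid_chimney_germ (F : set_system AA) : Prop :=
  exists F0 Fv,
    [/\ is_face F0, vface Fv, solid F0 Fv & F = chimney_germ F0 Fv].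

Definition splayed_chimney_germ (F : set_system AA) : Prop :=
  exists F0 Fv,
    [/\ is_face F0, vface Fv, spherical Fv & F = chimney_germ F0 Fv].

(** Points, germs of preordered intervals, generic rays and solid chimneys.  The
    germ of an interval is the germ at x of ]x, y]; it has the same enclosure as
    the germ of [x, y], and is contained in any set which contains the latter. *)
Definition MA2_filter (F : set_system AA) : Prop :=
  [\/ exists x, F = principal_filter x,
      exists x y, [/\ x <> y, leA x y \/ leA y x
                    & F = within (lopen_segment x y) (nbhs x)],
      exists x y, [/\ x <> y, generic (y - x) & F = globally (ray x y)]
    | solid_chimney F].

Record is_norm (N : AA -> R) : Prop := {
  norm_triangle : forall u v, N (u + v) <= N u + N v ;
  norm_homog : forall (a : R) u, N (a *: u) = `|a| * N u ;
  norm_definite : forall u, N u = 0 -> u = 0 }.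

Definition Wv_euclidean_norm (N : AA -> R) : Prop :=
  exists B : AA -> AA -> R,
    [/\ forall u v, B u v = B v u,
        forall (a : R) u v w, B (a *: u + v) w = a * B u w + B v w,
        forall u, u != 0 -> 0 < B u u,
        forall w u v, Wv w -> B (w u) (w v) = B u v
      & forall u, N u = Num.sqrt (B u u)].

End Apartment.

Record masure_data (R : realType) (V : vectorial_data) (T : Type) := MasureData {
  apt : set (set T) ;
  isomw : set T -> set (AA R V -> T) }.

Section Masure.
Variables (R : realType) (V : vectorial_data).
Variable g : kac_moody_algebra R[i] (@vd_C V).
Variables (T : Type) (M : masure_data R V T).

Local Notation AA := (AA R V).

(** A filter on an apartment is identified with the filter it generates on T:
    [fmap f F] for [F] a filter on the model and [f : AA -> T] a chart of the
    apartment.  Conversely, [pull f F] is the filter on the model defined by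
    a filter [F] on T to which [range f] belongs. *)
Definition pull (f : AA -> T) (F : set_system T) : set_system AA :=
  [set E | F (f @` E)].

(** The enclosure of [F] in the apartment with chart [f]. *)
Definition encl_in (f : AA -> T) (F : set_system T) : set_system T :=
  fmap f (encl g (pull f F)).

Definition filter_cup (F F' : set_system T) : set_system T :=
  [set E `|` E' | E in F & E' in F'].

(** Maps A -> A' are given by maps on T, of which only the restriction to A is
    considered. *)
Definition fixes_on (A : set T) (phi : T -> T) (F : set_system T) : Prop :=
  exists2 E, F E & forall x, A x -> E x -> phi x = x.

Definition isom_mod (Gam : set (AA -> AA)) (A A' : set T) (phi : T -> T) :=
  forall f f', isomw M A f -> isomw M A' f' ->
    exists2 w, Gam w & phi \o f = f' \o w.

Definition weyl_isom := isom_mod (@Wa R V).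
Definition isom := isom_mod (@WvA R V `&` @AutA R V).

(** Isomorphisms from the model apartment, whose isomw is W^a, to A. *)
Definition isom_model (A : set T) (psi : AA -> T) : Prop :=
  forall f, isomw M A f ->
    exists2 w, (@WvA R V `&` @AutA R V) w & psi = f \o w.

(** [F] is the image in some apartment of a filter satisfying [P]. *)
Definition in_some_apt (P : set_system AA -> Prop) (F : set_system T) : Prop :=
  exists A f F0, [/\ apt M A, isomw M A f, P F0 & F = fmap f F0].

Definition MA3_pair (Rg F : set_system T) : Prop :=
  in_some_apt (splayed_chimney_germ g) Rg /\
  (in_some_apt (is_face g) F \/ in_some_apt (solid_chimney_germ g) F).

Definition segment_in (A : set T) (x y : T) : set T :=
  [set z | exists f a b,
     [/\ isomw M A f, f a = x, f b = y & (f @` segment a b) z]].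

Definition le_in (A : set T) (x y : T) : Prop :=
  exists f a b, [/\ isomw M A f, f a = x, f b = y & leA a b].

Record is_masure : Prop := {
  ma_cover : forall x, exists2 A, apt M A & A x ;
  ma1 : forall A, apt M A -> exists2 f0, set_bij setT A f0 &
    isomw M A = [set f0 \o w | w in @Wa R V] ;
  ma2 : forall A A' f F, apt M A -> apt M A' -> isomw M A f ->
    MA2_filter g F -> fmap f F A' ->
    fmap f (encl g F) (A `&` A') /\
    exists2 phi, weyl_isom A A' phi & fixes_on A phi (fmap f (encl g F)) ;
  ma3 : forall Rg F, MA3_pair Rg F -> exists A, [/\ apt M A, Rg A & F A] ;
  ma4 : forall Rg F A A' f, MA3_pair Rg F -> apt M A -> apt M A' ->
    Rg A -> F A -> Rg A' -> F A' -> isomw M A f ->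
    exists2 phi, weyl_isom A A' phi &
      fixes_on A phi (encl_in f (filter_cup Rg F)) ;
  mao : forall A A' x y, apt M A -> apt M A' -> A x -> A y -> A' x -> A' y ->
    le_in A x y -> segment_in A x y = segment_in A' x y }.

(** [in_closure P C]: the filter P is contained in the closure of the filter C
    of an apartment, the closure being taken in this apartment. *)
Definition in_closure (P C : set_system T) : Prop :=
  exists A f C0, [/\ apt M A, isomw M A f, C = fmap f C0
    & forall E, C0 E -> P (f @` closure E)].

Definition panels_ok : Prop :=
  forall P, in_some_apt (is_panel g) P ->
    let S := [set C | in_some_apt (is_chamber g) C /\ in_closure P C] in
    finite_set S /\ ~ (S #<= `I_2)%card.

Section Action.
Variables (G : groupType) (act : G -> T -> T).

Record is_action : Prop := {
  act_1 : forall x, act 1%g x = x ;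
  act_M : forall h k x, act (h * k)%g x = act h (act k x) }.

Record strongly_transitive : Prop := {
  st_action : is_action ;
  st_apt : forall h A, apt M A -> apt M (act h @` A) ;
  st_isom : forall h A, apt M A -> isom A (act h @` A) (act h) ;
  st_ma2 : forall A A' f F, apt M A -> apt M A' -> isomw M A f ->
    MA2_filter g F -> fmap f F A' ->
    exists h, weyl_isom A A' (act h) /\
      fixes_on A (act h) (fmap f (encl g F)) ;
  st_ma4 : forall Rg F A A' f, MA3_pair Rg F -> apt M A -> apt M A' ->
    Rg A -> F A -> Rg A' -> F A' -> isomw M A f ->
    exists h, weyl_isom A A' (act h) /\
      fixes_on A (act h) (encl_in f (filter_cup Rg F)) }.

(** The model apartment is identified by [f0] with an apartment, whose
    stabilizer induces the semidirect product of W^v and Y. *)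
Definition stabilizer_induces_WvY (f0 : AA -> T) : Prop :=
  [/\ apt M (range f0), isomw M (range f0) f0 &
      [set phi : AA -> AA | exists h, act h @` range f0 = range f0 /\
                           act h \o f0 = f0 \o phi] = @WvY R V].

End Action.

Definition sector_germ_of_sign (eps : bool) (s : set_system T) : Prop :=
  in_some_apt
    (fun F => exists x Cv, vchamber_of_sign eps Cv /\ F = sface_germ x Cv) s.

Definition Theta (eps : bool) : set ((AA -> R) * set_system T) :=
  [set th | is_norm th.1 /\ sector_germ_of_sign eps th.2].

(** [splus eps s x u z] means z = x +_s u, for s of sign eps. *)
Definition splus (eps : bool) (s : set_system T) (x : T) (u : AA) (z : T) :=
  exists A psi a, [/\ [/\ apt M A, A x & s A], isom_model A psi,
    fmap psi (sface_germ 0 (sg eps @` @Cvf R V)) = s,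
    psi a = x & z = psi (a + sg eps u)].

Definition Uset (eps : bool) (s : set_system T) (x x' : T) : set (AA * AA) :=
  [set u | [/\ closure (@Cvf R V) u.1, closure (@Cvf R V) u.2
    & exists z, splus eps s x u.1 z /\ splus eps s x' u.2 z]].

Definition dtheta (eps : bool) (th : (AA -> R) * set_system T) (x x' : T) : R :=
  inf [set th.1 u.1 + th.1 u.2 | u in Uset eps th.2 x x'].

(** A masure is a building exactly when its vectorial Weyl group is finite. *)
Definition is_building : Prop := finite_set (@Wv R V).

(** The distance d_I for the invariant Euclidean norm N; [get] picks the unique
    element of the set. *)
Definition building_dist (N : AA -> R) (x x' : T) : R :=
  get [set r | exists A psi a a', [/\ apt M A, isom_model A psi,
         psi a = x, psi a' = x' & r = N (a' - a)]].

End Masure.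

(* Main.v *)
(** A building retracts onto any of its apartments from a positive sector-germ
    [s]: each point lies in an apartment containing [s], and one keeps the
    coordinates of the point in the chart of that apartment which agrees near
    [s] with a fixed chart.  At each point of a segment of an apartment, both
    germs of the segment lie in an apartment containing [s], so by compactness
    a segment is cut into finitely many pieces along which the retraction is an
    isometry: the retraction does not increase [d_I].  This makes [d_I] well
    defined and yields its triangle inequality, and as [x] and [x +_s u] are at
    distance [N u], the bound [k d_I <= d_theta] follows by comparing the two
    norms.  Conversely, along a piece contained in one apartment with [s], a
    vector [v] is the difference of the dominant vectors [v + t rho] and
    [t rho], with [t] of the order of [N v]; these add up along the segment. *)
From HB Require Import structures.
Require Import Defs.
From mathcomp Require Import all_boot all_order all_algebra.
From mathcomp Require Import all_classical all_reals all_analysis.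
From mathcomp Require Import ring lra.

Set Implicit Arguments.
Unset Strict Implicit.
Unset Printing Implicit Defensive.

Import Order.TTheory GRing.Theory Num.Theory.
Import numFieldNormedType.Exports.

Local Open Scope classical_set_scope.
Local Open Scope ring_scope.

(** * The Weyl groups *)

Section Apartment.
Variables (R : realType) (V : vectorial_data).
Local Notation AA := (AA R V).
Local Notation alpha := (@simple_root R V).
Local Notation coalpha := (@simple_coroot R V).
Local Notation refl := (@refl R V).
Local Notation Wv := (@Wv R V).
Local Notation Wa := (@Wa R V).

Lemma simple_root_linear i (c : R) (u v : AA) :
  alpha i (c *: u + v) = c * alpha i u + alpha i v.
Proof.
rewrite /simple_root /Defs.form mulr_sumr -big_split /=; apply: eq_bigr => k _.
rewrite !mxE; ring.
Qed.

Lemma simple_root0 i : alpha i 0 = 0.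
Proof. by rewrite /simple_root /Defs.form big1 // => k _; rewrite mxE mulr0. Qed.

Lemma simple_rootD i (u v : AA) : alpha i (u + v) = alpha i u + alpha i v.
Proof. by rewrite -{1}[u]scale1r simple_root_linear mul1r. Qed.

Lemma simple_rootZ i (c : R) (u : AA) : alpha i (c *: u) = c * alpha i u.
Proof. by rewrite -[X in alpha i X]addr0 simple_root_linear simple_root0 addr0. Qed.

Lemma simple_rootN i (u : AA) : alpha i (- u) = - alpha i u.
Proof. by rewrite -scaleN1r simple_rootZ mulN1r. Qed.

Lemma simple_root_coroot i j : alpha j (coalpha i) = (vd_C i j)%:~R.
Proof.
rewrite -vd_pairing /simple_root /Defs.form rmorph_sum /=; apply: eq_bigr => k _.
by rewrite mxE intrM.
Qed.

Lemma simple_root_coroot2 i : alpha i (coalpha i) = 2.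
Proof. by rewrite simple_root_coroot (kmm_diag (vd_kmm V)). Qed.

Lemma simple_coroot_neq0 i : coalpha i != 0.
Proof.
by apply/eqP => c0; move: (simple_root_coroot2 i); rewrite c0 simple_root0; lra.
Qed.

Lemma refl_linear i : linear (refl i).
Proof.
move=> c u v; rewrite /Defs.refl simple_root_linear scalerDl scalerBr scalerA.
by rewrite opprD addrACA.
Qed.

Lemma refl_invol i : refl i \o refl i = id.
Proof.
apply/funext => v /=; rewrite /Defs.refl simple_rootD simple_rootN simple_rootZ.
rewrite simple_root_coroot2 -addrA -opprD -scalerDl.
have -> : alpha i v + (alpha i v - alpha i v * 2) = 0 by ring.
by rewrite scale0r subr0.
Qed.

Lemma Wv_linear w : Wv w -> exists L : {linear AA -> AA}, w = L.
Proof.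
elim=> [|i {}w _ [L ->]]; first by exists (idfun : {linear AA -> AA}).
pose m := GRing.isLinear.Build R AA AA _ (refl i) (@refl_linear i).
pose r : {linear AA -> AA} := HB.pack (refl i) m.
by exists (r \o L : {linear AA -> AA}).
Qed.

Lemma Wv_comp w w' : Wv w -> Wv w' -> Wv (w \o w').
Proof. by move=> + Ww'; elim=> // i {}w _; exact: (@Wv_refl _ _ i). Qed.

Lemma Wv_inv w : Wv w -> exists w', [/\ Wv w', w \o w' = id & w' \o w = id].
Proof.
elim=> [|i {}w Ww [w' [Ww' ww' w'w]]]; first by exists id; split=> //; exact: Wv_id.
exists (w' \o refl i); split.
- apply: Wv_comp => //; exact: (Wv_refl i (@Wv_id R V)).
- by rewrite compA -[_ \o w']/(refl i \o (w \o w')) ww'; exact: refl_invol.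
- rewrite -[LHS]/(w' \o (refl i \o refl i) \o w) refl_invol.
  by rewrite -[LHS]/(w' \o w).
Qed.

Lemma coroot_latticeD (p q : AA) :
  coroot_lattice p -> coroot_lattice q -> coroot_lattice (p + q).
Proof.
move=> [m _ <-] [n _ <-]; exists (fun i => m i + n i) => //.
by rewrite -big_split /=; apply: eq_bigr => i _; rewrite mulrzDr.
Qed.

Lemma coroot_latticeN (p : AA) : coroot_lattice p -> coroot_lattice (- p).
Proof.
move=> [m _ <-]; exists (fun i => - m i) => //.
by rewrite -sumrN; apply: eq_bigr => i _; rewrite mulrNz.
Qed.

Lemma coroot_lattice0 : coroot_lattice (0 : AA).
Proof. by exists (fun=> 0) => //; rewrite big1. Qed.

Lemma coroot_lattice_int i (p : AA) :
  coroot_lattice p -> exists m : int, alpha i p = m%:~R.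
Proof.
move=> [n _ <-]; exists (\sum_j vd_C j i * n j).
rewrite rmorph_sum /=; elim/big_rec2: _ => [|j y1 y2 _ <-]; first exact: simple_root0.
rewrite simple_rootD -scaler_int simple_rootZ simple_root_coroot.
by rewrite intrM mulrC.
Qed.

Lemma coroot_lattice_Wv w (p : AA) :
  Wv w -> coroot_lattice p -> coroot_lattice (w p).
Proof.
elim=> // i {}w _ IH /IH {}IH /=; rewrite /Defs.refl.
have [m ->] := coroot_lattice_int i IH.
apply: coroot_latticeD => //; apply: coroot_latticeN.
exists (fun j => if j == i then m else 0) => //.
rewrite (bigD1 i) //= eqxx big1 ?addr0 ?scaler_int // => j /negPf ->.
by rewrite mulr0z.
Qed.

Lemma Wa_Wv w : Wv w -> Wa w.
Proof.
move=> Ww; exists w, 0; split=> //; first exact: coroot_lattice0.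
by apply/funext => x; rewrite addr0.
Qed.

Lemma Wa_comp p q : Wa p -> Wa q -> Wa (p \o q).
Proof.
move=> [w [a [Ww Qa ->]]] [w' [a' [Ww' Qa' ->]]].
exists (w \o w'), (w a' + a); split; first exact: Wv_comp.
  by apply: coroot_latticeD => //; exact: coroot_lattice_Wv.
apply/funext => x /=; have [L ->] := Wv_linear Ww.
by rewrite linearD addrA.
Qed.

Lemma Wa_inv p : Wa p -> exists q, [/\ Wa q, p \o q = id & q \o p = id].
Proof.
move=> [w [a [Ww Qa ->]]]; have [w' [Ww' ww' w'w]] := Wv_inv Ww.
exists (fun x => w' x + w' (- a)); split.
- exists w', (w' (- a)); split=> //.
  by apply: coroot_lattice_Wv => //; exact: coroot_latticeN.
- apply/funext => x /=; have [L LE] := Wv_linear Ww.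
  have ww'E y : w (w' y) = y := congr1 (@^~ y) ww'.
  by rewrite LE linearD -LE !ww'E subrK.
- apply/funext => x /=; have [L LE] := Wv_linear Ww'.
  rewrite LE -linearD -LE addrK; exact: (congr1 (@^~ x) w'w).
Qed.

(** The map x -> w x + q sends M(b, k) to the wall of b o w^-1 at level k - b(w^-1 q); the level
    stays integral because real roots are integral on the coroot lattice, which W^v preserves. *)
Lemma walls_Wa p (a : set AA * AA) : Wa p -> walls a ->
  walls (p @` a.1, p a.2 - p 0).
Proof.
move=> [w [q [Ww Qq ->]]] [[b bv] [k [[v [i [Wu /= bE ->]]] ->]]] /=.
have [w' [Ww' ww' w'w]] := Wv_inv Ww.
have [v' [Wv' vv' v'v]] := Wv_inv Wu.
have w'wE y : w' (w y) = y := congr1 (@^~ y) w'w.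
have ww'E y : w (w' y) = y := congr1 (@^~ y) ww'.
have vv'E y : v (v' y) = y := congr1 (@^~ y) vv'.
have bvE y : b (v y) = alpha i y := congr1 (@^~ y) bE.
have [m mE] : exists m : int, b (w' q) = m%:~R.
  rewrite -[w' q]vv'E bvE; apply: coroot_lattice_int.
  by do 2! apply: coroot_lattice_Wv => //.
have bD x y : b (x + y) = b x + b y.
  rewrite -[x]vv'E -[y]vv'E; have [L ->] := Wv_linear Wv'.
  by have [L' LE] := Wv_linear Wu; rewrite LE -linearD -LE !bvE simple_rootD.
have [L LE] := Wv_linear Ww; have [L' LE'] := Wv_linear Ww'.
exists (b \o w', w (v (coalpha i))), (k - m); split=> /=.
  exists (w \o v), i; split=> //=; first exact: Wv_comp.
  by apply/funext => y /=; rewrite w'wE bvE.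
congr pair; last first.
  by rewrite LE linear0 add0r addrK.
apply/seteqP; split=> [_ [x bx <-]|x]; rewrite /hyper /=.
  rewrite /hyper /= in bx.
  by rewrite LE' linearD -LE' w'wE bD mE -[RHS]bx intrB; ring.
move=> bx; exists (w' (x - q)); last by rewrite ww'E subrK.
rewrite /hyper /= -[RHS]bx LE' linearB -LE'.
have -> : b (w' x - w' q) = b (w' x) - b (w' q).
  by apply/eqP; rewrite eq_sym subr_eq -bD subrK.
by rewrite mE intrB; ring.
Qed.

(** This makes every Weyl chart an isomorphism from the model. Applying [walls_Wa] to the inverse
    shows that each wall is attained. *)
Lemma Wa_WvA_AutA p : Wa p -> (@WvA R V `&` @AutA R V) p.
Proof.
move=> Wp; have [q [Wq pq qp]] := Wa_inv Wp; split.
  by move: Wp => [w [a [Ww _ ->]]]; exists w, a.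
split.
  split.
    by exists q => x; [exact: (congr1 (@^~ x) qp)|exact: (congr1 (@^~ x) pq)].
  move: Wp => [w [a [Ww _ ->]]]; have [L ->] := Wv_linear Ww.
  by exists L, a.
apply/seteqP; split=> [_ [a aW <-]|a aW]; first exact: walls_Wa.
exists (q @` a.1, q a.2 - q 0); first exact: walls_Wa.
have pqE y : p (q y) = y := congr1 (@^~ y) pq.
case: a {aW} => a1 a2 /=; congr pair.
  by rewrite image_comp pq image_id.
move: Wp pqE => [w [t [Ww _ ->]]] /=; have [L ->] := Wv_linear Ww => pqE.
rewrite linearB linear0 add0r addrK.
rewrite -[RHS]pqE; congr (_ + _); apply/eqP.
by rewrite eq_sym -addr_eq0 addrC pqE.
Qed.

End Apartment.

(** Take the supremum of the points of [0, 1] where [Q] holds. The first local clause carries [Q]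
    from a nearby point up to the supremum, and the second carries it further unless the supremum is
    1. *)
Lemma interval_induction (R : realType) (Q : R -> Prop) : Q 0 ->
  (forall t, 0 <= t <= 1 -> exists2 e : R, 0 < e & forall s, 0 <= s <= 1 ->
     (t - e <= s <= t -> Q s -> Q t) /\ (t <= s <= t + e -> Q t -> Q s)) ->
  Q 1.
Proof.
move=> Q0 Qloc; pose S := [set t | 0 <= t <= 1 /\ Q t].
have S0 : S 0 by split=> //; rewrite lexx ler01.
have Sub : ubound S 1 by move=> t [/andP[]].
have Ssup : has_sup S by split; [exists 0|exists 1].
have s01 : 0 <= sup S <= 1.
  by apply/andP; split; [exact: ub_le_sup Ssup.2 _ S0|exact: ge_sup Ssup.1 Sub].
have [e e0 eQ] := Qloc _ s01; have [t [t01 Qt] st] := sup_adherent e0 Ssup.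
have ts : t <= sup S by apply: ub_le_sup Ssup.2 _ _; split.
have Qs : Q (sup S) by apply: (eQ t t01).1 => //; rewrite ts ltW.
case: (ltP (sup S) 1) => [s1|s1]; last first.
  by have -> : 1 = sup S by apply/eqP; rewrite eq_le s1; case/andP: s01.
pose u := Num.min 1 (sup S + e).
have su : sup S < u by rewrite lt_min s1 ltrDl.
have u01 : 0 <= u <= 1.
  by rewrite ge_min lexx /= (le_trans _ (ltW su)) //; case/andP: s01.
have Qu : Q u by apply: (eQ u u01).2 => //; rewrite ltW //= ge_min lexx orbT.
by have : u <= sup S := ub_le_sup Ssup.2 (conj u01 Qu); rewrite leNgt su.
Qed.

Lemma seq_has_max (R : realDomainType) (s : seq R) x : x \in s ->
  exists2 m, m \in s & forall y, y \in s -> y <= m.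
Proof.
elim: s x => // a s IH x _; case: s IH => [|b s] IH.
  by exists a => [|y]; rewrite inE // => /eqP ->.
have [m ms mmax] := IH b (mem_head _ _); case: (leP a m) => am.
  by exists m => [|y]; rewrite inE ?ms ?orbT // => /predU1P[->|/mmax].
exists a => [|y]; rewrite inE ?eqxx // => /predU1P[->//|/mmax ym].
exact: le_trans ym (ltW am).
Qed.

(** * Dominant vectors and sector-germs *)

Section Dominant.
Variables (R : realType) (V : vectorial_data).
Local Notation I := (vd_I V).
Local Notation AA := (AA R V).
Local Notation alpha := (@simple_root R V).
Local Notation coalpha := (@simple_coroot R V).
Local Notation refl := (@refl R V).
Local Notation Wv := (@Wv R V).
Local Notation Cvf := (@Cvf R V).

Definition simple_root_mx : 'M[rat]_(#|I|, vd_rank V) :=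
  \matrix_(i, k) (vd_alpha (enum_val i) 0 k)%:~R.

(** Multiplying a rational relation by the product [d] of its denominators gives an integral one,
    which is trivial by [vd_alpha_free]. *)
Lemma row_free_simple_root_mx : row_free simple_root_mx.
Proof.
rewrite -kermx_eq0; apply/rowV0P => v /sub_kermxP vA.
pose d : int := \prod_j denq (v 0 j).
pose c (i : I) : int :=
  numq (v 0 (enum_rank i)) * \prod_(k | k != enum_rank i) denq (v 0 k).
have cE i : (c i)%:~R = d%:~R * v 0 (enum_rank i) :> rat.
  have -> : d = denq (v 0 (enum_rank i)) *
      \prod_(k | k != enum_rank i) denq (v 0 k) by rewrite /d (bigD1 (enum_rank i)).
  by rewrite /c !intrM numqE; ring.
have d0 : d%:~R != 0 :> rat.
  by rewrite intr_eq0; apply/prodf_neq0 => k _; exact: denq_neq0.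
have c0 : \sum_i vd_alpha i *~ c i = 0.
  apply/rowP => k; apply: (@intr_inj rat); rewrite summxE !mxE rmorph_sum /=.
  have /rowP/(_ k) := vA; rewrite !mxE => /(congr1 ( *%R d%:~R)).
  rewrite mulr0 => vA0; apply: etrans vA0; rewrite mulr_sumr.
  rewrite (reindex (fun j : 'I_#|I| => enum_val j)) /=; last first.
    by apply: onW_bij; exact: enum_val_bij.
  apply: eq_bigr => i _; have := cE (enum_val i); rewrite enum_valK => ci.
  rewrite [in RHS]mxE mulrA -ci.
  by rewrite -scaler_int mxE intrM intz mulrC.
apply/rowP => k; rewrite mxE.
have := vd_alpha_free c0 (enum_val k) => /(congr1 (fun m : int => m%:~R : rat)).
by rewrite cE enum_valK => /eqP; rewrite mulf_eq0 (negPf d0) => /eqP.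
Qed.

Lemma exists_rho : exists rho : AA, forall i, alpha i rho = 1.
Proof.
(* The rows being free, the pseudo-inverse is a right inverse, so all simple roots equal 1 on the
   rational vector [w]. *)
pose w : 'cV[rat]_(vd_rank V) := pinvmx simple_root_mx *m const_mx 1.
exists (\row_k ratr (w k 0)) => i.
have : (simple_root_mx *m w) (enum_rank i) 0 = 1.
  by rewrite mulmxA mulmxVp ?row_free_simple_root_mx // mul1mx mxE.
rewrite mxE => /(congr1 (@ratr R)); rewrite rmorph1 => <-.
rewrite rmorph_sum /simple_root /Defs.form /=; apply: eq_bigr => k _.
by rewrite rmorphM /= !mxE enum_rankK ratr_int.
Qed.

Definition rho : AA := sval (cid exists_rho).

Lemma simple_root_rho i : alpha i rho = 1.
Proof. exact: (svalP (cid exists_rho)). Qed.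

Lemma simple_root_shift i (v : AA) t : alpha i (v + t *: rho) = alpha i v + t.
Proof. by rewrite simple_rootD simple_rootZ simple_root_rho mulr1. Qed.

Lemma nbhs_line (y v : AA) (Om : set AA) : nbhs y Om ->
  exists2 e : R, 0 < e & forall t, 0 <= t <= e -> Om (y + t *: v).
Proof.
move=> yOm; have : (y + t *: v) @[t --> (0 : R)] --> y.
  have {2}-> : y = y + 0 *: v by rewrite scale0r addr0.
  apply: cvgD; first exact: cvg_cst.
  by apply: cvgZr_tmp; exact: cvg_id.
move=> /(_ _ yOm) /nbhs_ballP[e /= e0 eOm]; exists (e / 2); first by lra.
by move=> t /andP[t0 te]; apply: eOm; rewrite /ball /= sub0r normrN ger0_norm; lra.
Qed.

Lemma closure_Cvf (v : AA) : (forall i, 0 <= alpha i v) -> closure Cvf v.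
Proof.
move=> v0 B /(nbhs_line rho)[e e0 eB]; exists (v + e *: rho); split.
  by move=> i; rewrite simple_root_shift; have := v0 i; lra.
by apply: eB; rewrite lexx ltW.
Qed.

(** These sets form a basis of the germ at infinity of the dominant sector: they and the translates
    of [Cvf] are cofinal in each other. *)
Definition deep (c : R) : set AA := [set a | forall i, c < alpha i a].

Lemma bound_simple_roots (v : AA) :
  exists2 c : R, 0 <= c & forall i, `|alpha i v| <= c.
Proof.
exists (\sum_i `|alpha i v|); first by apply: sumr_ge0.
by move=> i; rewrite (bigD1 i) //= lerDl sumr_ge0.
Qed.

Lemma deep_shift c (v : AA) : exists2 c', 0 <= c' &
  forall a, deep c' a -> deep c (a + v).
Proof.
have [b b0 vb] := bound_simple_roots v; exists (`|c| + b).
  by rewrite addr_ge0.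
move=> a ca i; rewrite simple_rootD.
have := ca i; have := vb i; have := ler_norm c; rewrite ler_norml.
by move=> ? /andP[? ?] ?; lra.
Qed.

Lemma shift_Cvf (a : AA) :
  exists c, deep c `<=` [set a + v | v in Cvf].
Proof.
have [c _ cP] := deep_shift 0 (- a); exists c => b /cP bC.
by exists (b - a) => //; rewrite addrC subrK.
Qed.

Lemma deep_rho c t : c <= t -> forall v, Cvf v -> deep c (t *: rho + v).
Proof.
by move=> ct v vC i; rewrite addrC simple_root_shift; have := vC i; lra.
Qed.

Lemma sface_germ_deep x w E : Wv w ->
  sface_germ x (w @` Cvf) E <-> exists c, forall a, deep c a -> E (w a).
Proof.
move=> Ww; have [w' [Ww' ww' w'w]] := Wv_inv Ww.
have ww'E y : w (w' y) = y := congr1 (@^~ y) ww'.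
have w'wE y : w' (w y) = y := congr1 (@^~ y) w'w.
have [L LE] := Wv_linear Ww; split.
  move=> [u _ uE]; have [c cP] := shift_Cvf (w' (x + u)).
  exists c => _ /cP[v vC <-]; rewrite LE linearD -LE ww'E.
  by apply: uE; exists (w v) => //; exists v.
move=> [c cE]; have [c' c'0 c'P] := deep_shift c (w' x).
(* The constant [c'] absorbs the base point x, so beyond this point the sector lies in the image of
   [deep c]. *)
exists (w ((c' + 1) *: rho)).
  apply: subset_closure; exists ((c' + 1) *: rho) => // i.
  by rewrite simple_rootZ simple_root_rho; lra.
move=> _ [_ [v vC <-] <-]; rewrite -{1}[x]ww'E LE -!linearD -LE.
apply: cE; rewrite -addrA addrC; apply: c'P; apply: deep_rho => //; lra.
Qed.

(** In the finite orbit of v, a vector whose scalar product with rho is largest is dominant; [J]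
    then collects the simple roots vanishing on it. *)
Lemma Wv_Fv0 (N : AA -> R) : finite_set Wv -> Wv_euclidean_norm N ->
  forall v, exists w J, Wv w /\ (w @` @Fv0 R V J) v.
Proof.
move=> finW [B [Bsym Blin Bpos Binv NE]] v.
have BD u v' w : B (u + v') w = B u w + B v' w.
  by rewrite -{1}[u]scale1r Blin mul1r.
have B0 w : B 0 w = 0 by have := BD 0 0 w; rewrite addr0; lra.
have BZ c u w : B (c *: u) w = c * B u w.
  by rewrite -[X in B X]addr0 Blin B0 addr0.
have BN u w : B (- u) w = - B u w by rewrite -scaleN1r BZ mulN1r.
(* This is invariance under the reflection, which negates the coroot. In particular the coroot has a
   positive product with rho. *)
have Bpair i u : 2 * B (coalpha i) u = alpha i u * B (coalpha i) (coalpha i).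
  have := Binv (refl i \o id) (coalpha i) u (Wv_refl i (@Wv_id R V)).
  rewrite /= /Defs.refl simple_root_coroot2 scaler_nat mulr2n.
  rewrite opprD addrA subrr add0r BN Bsym BD BN BZ (Bsym u).
  lra.
pose S := [set B (w v) rho | w in Wv].
have [w Ww wmax] : exists2 w, Wv w & forall w', Wv w' -> B (w' v) rho <= B (w v) rho.
  have : finite_set S by exact: finite_image.
  move=> /finite_seqP[s sE].
  have Sid : S (B v rho) by exists id => //; exact: Wv_id.
  have [|m ms mmax] := @seq_has_max R s (B v rho).
    by move: Sid; rewrite sE.
  have [w Ww wE] : S m by rewrite sE.
  exists w => // w' Ww'; rewrite wE; apply: mmax.
  by have : S (B (w' v) rho) by [exists w']; rewrite sE.
have pos i : 0 <= alpha i (w v).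
  (* Reflecting [w v] subtracts [alpha i (w v)] times a positive number from its product with rho,
     and maximality makes this loss nonnegative. *)
  have := wmax _ (Wv_refl i Ww); rewrite /= /Defs.refl BD BN BZ.
  have := Bpair i rho; rewrite simple_root_rho mul1r.
  have := Bpos _ (simple_coroot_neq0 R i); move: (B _ _) (B _ _) (alpha i (w v)) => b c a.
  move=> b0 bc le; nra.
have [w' [Ww' ww' w'w]] := Wv_inv Ww.
exists w', [set i | alpha i (w v) == 0]%SET; split=> //.
exists (w v); last exact: (congr1 (@^~ v) w'w).
by move=> i; rewrite inE; case: eqVneq => // n0; rewrite lt0r n0 pos.
Qed.

End Dominant.

(** * Norms on the model apartment *)

Section Norms.
Variables (R : realType) (V : vectorial_data).
Local Notation AA := (AA R V).

Lemma euclidean_is_norm (N : AA -> R) : Wv_euclidean_norm N -> is_norm N.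
Proof.
move=> [B [Bsym Blin Bpos _ NE]].
have BD u v w : B (u + v) w = B u w + B v w by rewrite -{1}[u]scale1r Blin mul1r.
have B0 w : B 0 w = 0 by have := BD 0 0 w; rewrite addr0; lra.
have BZ c u w : B (c *: u) w = c * B u w by rewrite -[X in B X]addr0 Blin B0 addr0.
have Bge u : 0 <= B u u.
  by have [->|/Bpos/ltW//] := eqVneq u 0; rewrite B0.
have CS u v : B u v <= N u * N v.
  have [->|v0] := eqVneq v 0; first by rewrite Bsym B0 !NE B0 sqrtr0 mulr0.
  (* Here c v is the orthogonal projection of u on v; positivity of the form at u - c v is the
     Cauchy-Schwarz inequality. *)
  have vv := Bpos _ v0; set c := B u v / B v v.
  have cE : c * B v v = B u v by rewrite /c divfK // gt_eqF.
  have := Bge (u + - c *: v).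
  rewrite BD BZ (Bsym u) (Bsym v) !BD !BZ (Bsym v u) => uv.
  have le2 : B u v ^+ 2 <= B u u * B v v.
    have := mulr_ge0 uv (ltW vv); rewrite -cE; nra.
  rewrite !NE -sqrtrM //; apply: le_trans (ler_norm _) _.
  by rewrite -sqrtr_sqr ler_wsqrtr.
have N2 u : N u ^+ 2 = B u u by rewrite NE sqr_sqrtr.
have N0 u : 0 <= N u by rewrite NE sqrtr_ge0.
split=> [u v|a u|u].
- rewrite -(@ler_pXn2r _ 2) ?nnegrE ?addr_ge0 // sqrrD !N2.
  rewrite BD !(Bsym _ (u + v)) !BD (Bsym v u).
  by have := CS u v; rewrite mulr2n; lra.
- by rewrite !NE BZ Bsym BZ mulrA sqrtrM ?sqr_ge0 // -expr2 sqrtr_sqr.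
- move=> Nu; apply: contra_eq (N2 u) => /Bpos.
  by rewrite Nu expr0n /= lt_def => /andP[]; rewrite eq_sym.
Qed.

Lemma norm0 (N : AA -> R) : is_norm N -> N 0 = 0.
Proof. by move=> nN; rewrite -(scale0r 0) (norm_homog nN) normr0 mul0r. Qed.

Lemma normN (N : AA -> R) u : is_norm N -> N (- u) = N u.
Proof. by move=> nN; rewrite -scaleN1r (norm_homog nN) normrN1 mul1r. Qed.

Lemma norm_ge0 (N : AA -> R) u : is_norm N -> 0 <= N u.
Proof.
by move=> nN; have := norm_triangle nN u (- u); rewrite normN // subrr norm0 //; lra.
Qed.

Lemma norm_le_mx_norm (N : AA -> R) : is_norm N ->
  exists2 C : R, 0 < C & forall u, N u <= C * `|u|.
Proof.
move=> nN; pose S := \sum_(k < vd_rank V) N (delta_mx 0 k).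
have S0 : 0 <= S by apply: sumr_ge0 => k _; exact: norm_ge0.
exists (S + 1) => [|u]; first by lra.
apply: (@le_trans _ _ (S * `|u|)); last by rewrite ler_wpM2r ?normr_ge0 //; lra.
rewrite [u in N u]row_sum_delta /S mulr_suml.
elim/big_ind2: _ => [|x1 x2 y1 y2 h1 h2|k _]; first by rewrite norm0.
  by apply: le_trans (norm_triangle nN _ _) _; exact: lerD.
rewrite (norm_homog nN) mulrC ler_wpM2l ?norm_ge0 //.
rewrite -[X in _ <= X]/(mx_norm u) mx_normrE.
exact: (le_bigmax _ (fun ij => `|u ij.1 ij.2|) (0, k)).
Qed.

(** [P] is bounded by a multiple of the maximum norm. [Q] is continuous, so its image of the unit
    sphere is compact and avoids 0, hence stays above some [e]; homogeneity does the rest. *)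
Lemma norm_equiv (P Q : AA -> R) : is_norm P -> is_norm Q ->
  exists2 C : R, 0 < C & forall u, P u <= C * Q u.
Proof.
move=> nP nQ; have [C C0 PC] := norm_le_mx_norm nP.
have [D D0 QD] := norm_le_mx_norm nQ.
have Qdist u v : Q u - Q v <= D * `|u - v|.
  apply: le_trans (QD _); have := norm_triangle nQ (u - v) v.
  by rewrite subrK; lra.
have Qcont : continuous Q.
  move=> u A /nbhs_ballP[e /= e0 eA]; apply/nbhs_ballP.
  exists (e / D) => /=; first exact: divr_gt0.
  move=> v; rewrite -ball_normE /= ltr_pdivlMr // mulrC => uv.
  apply: eA; rewrite /ball /= ltr_norml.
  by have := Qdist u v; have := Qdist v u; rewrite distrC; lra.
have cS : compact [set u : AA | `|u| = 1].
  apply: bounded_closed_compact.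
    by exists 1; split=> // M M1 u /= ->; exact: ltW.
  have /continuous_closedP/(_ [set 1]) := @norm_continuous R AA.
  by apply; exact: closed_eq.
have clQ : closed (Q @` [set u : AA | `|u| = 1]).
  apply: compact_closed => //; apply: continuous_compact => //.
  exact: continuous_subspaceT.
have : nbhs (0 : R) (~` (Q @` [set u : AA | `|u| = 1])).
  apply: open_nbhs_nbhs; split; first exact: closed_openC.
  move=> [u u1 /(norm_definite nQ) u0]; move: u1; rewrite /= u0 normr0 => /eqP.
  by rewrite eq_sym oner_eq0.
move=> /nbhs_ballP[e /= e0 eQ].
exists (C / e); first exact: divr_gt0.
move=> u; apply: le_trans (PC u) _; rewrite -mulrA ler_wpM2l ?(ltW C0) //.
have [->|u0] := eqVneq u 0; first by rewrite normr0 norm0 // mulr0.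
have nu0 : 0 < `|u| by rewrite normr_gt0.
have : e <= Q (`|u|^-1 *: u).
  rewrite leNgt; apply/negP => Qe.
  have := eQ (Q (`|u|^-1 *: u)); rewrite /ball /= sub0r normrN ger0_norm ?norm_ge0 //.
  move=> /(_ Qe); apply; exists (`|u|^-1 *: u) => //=.
  by rewrite normrZ normfV normr_id mulVf // gt_eqF.
rewrite (norm_homog nQ) normfV normr_id mulrC ler_pdivlMr // => eu.
by rewrite mulrC ler_pdivlMr // mulrC.
Qed.

(** Adding the ambient norm to the sum of the absolute values of the simple roots gives a norm, to
    which [norm_equiv] applies. *)
Lemma simple_roots_bounded (N : AA -> R) : is_norm N ->
  exists2 K : R, 0 < K & forall i u, `|simple_root i u| <= K * N u.
Proof.
move=> nN; pose P (u : AA) := `|u| + \sum_i `|simple_root i u|.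
have nP : is_norm P.
  split=> [u v|a u|u].
  - rewrite /P addrACA lerD ?ler_normD // -big_split /= ler_sum // => i _.
    by rewrite simple_rootD ler_normD.
  - rewrite /P normrZ mulrDr mulr_sumr; congr (_ + _); apply: eq_bigr => i _.
    by rewrite simple_rootZ normrM.
  - move=> /eqP; rewrite paddr_eq0 ?sumr_ge0 // => /andP[/eqP u0 _].
    exact: normr0_eq0.
have [K K0 PK] := norm_equiv nP nN; exists K => // i u.
apply: le_trans (PK u); rewrite /P (bigD1 i) //= addrCA lerDl addr_ge0 //.
by rewrite sumr_ge0.
Qed.

End Norms.

(** * Chimneys based at a point *)

Section Roots.
Variables (R : realType) (V : vectorial_data).
Variable g : kac_moody_algebra R[i] (@vd_C V).
Local Notation I := (vd_I V).
Local Notation AA := (AA R V).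
Local Notation alpha := (@simple_root R V).
Local Notation Cvf := (@Cvf R V).
Local Notation F00 := (@Fv0 R V [set: I]%SET).

Definition indic (i : I) : {ffun I -> int} := [ffun j => if j == i then 1 else 0].

(** The bracket of e_i and f_i is the i-th coroot, which is nonzero since the coroots are free and
    [kma_h] is injective. *)
Lemma kma_e_neq0 i : kma_e g i != 0.
Proof.
apply/eqP => e0; have := kma_ef g i i; rewrite eqxx e0.
have -> : kma_br 0 (kma_f g i) = 0.
  have := kma_br_linl (k := g) 1 0 0 (kma_f g i).
  rewrite !scale1r addr0.
  by move=> /(congr1 (+%R^~ (- kma_br 0 (kma_f g i)))); rewrite addrK subrr => <-.
rewrite -(linear0 (kma_h g)) => /kma_h_inj h0.
have c0 : \sum_j (if j == i then 1 else 0) *: kma_coroot g j = 0.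
  rewrite (bigD1 i) //= eqxx scale1r -h0 add0r big1 // => j /negPf ->.
  by rewrite scale0r.
by have /eqP := kma_coroot_free c0 i; rewrite eqxx oner_eq0.
Qed.

Lemma Delta_indic i : Delta g (indic i).
Proof.
split.
  apply/eqP => /(congr1 (@^~ i)); rewrite /= ffunE eqxx => /eqP.
  by rewrite oner_eq0.
exists (kma_e g i); split; first exact: kma_e_neq0.
move=> h; rewrite kma_he (bigD1 i) //= ffunE eqxx mulr1z big1 ?addr0 //.
by move=> j ji; rewrite ffunE (negPf ji) mulr0z.
Qed.

Lemma Qform_indic i (v : AA) : Qform (indic i) v = alpha i v.
Proof.
rewrite /Qform (bigD1 i) //= ffunE eqxx mul1r big1 ?addr0 //.
by move=> j ji; rewrite ffunE (negPf ji) mul0r.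
Qed.

Lemma Qform_line n t (u v : AA) : Qform n (u + t *: v) = Qform n u + t * Qform n v.
Proof.
rewrite /Qform mulr_sumr -big_split /=; apply: eq_bigr => i _.
by rewrite simple_rootD simple_rootZ; ring.
Qed.

Lemma Fv00P (v : AA) : F00 v -> forall i, alpha i v = 0.
Proof. by move=> vF i; have := vF i; rewrite inE. Qed.

Lemma Fv00_0 : F00 0.
Proof. by move=> i; rewrite inE simple_root0. Qed.

Lemma Qform_Fv00 n (v : AA) : F00 v -> Qform n v = 0.
Proof. by move=> /Fv00P v0; rewrite /Qform big1 // => i _; rewrite v0 mulr0. Qed.

Lemma lfaceS x Fv (E E' : set AA) : E `<=` E' -> lface g x Fv E -> lface g x Fv E'.
Proof.
move=> EE' [k [k' [Om [xOm PE OmP]]]]; exists k, k', Om; split=> //.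
exact: subset_trans PE EE'.
Qed.

Lemma lface_point x (E : set AA) : lface g x F00 E -> E x.
Proof.
move=> [k [k' [Om [xOm PE OmP]]]]; apply: PE; apply: OmP.
by split; [exact: nbhs_singleton|exists 0; rewrite ?addr0//; exact: Fv00_0].
Qed.

(** All roots vanish on [F00], so a half-apartment containing x contains x + [F00]. Thus (MA2) at a
    point also controls the face based there, as (MA4) requires. *)
Lemma encl_principal x (E : set AA) :
  encl g (principal_filter x) E -> lface g x F00 E.
Proof.
move=> [k [/principal_filterP xP PE]]; exists k, (fun=> None), setT; split.
- exact: filterT.
- by move=> y yP; apply: PE => n nD; have [] := yP n nD.
- move=> _ [_ [v vF <-]] n nD; split=> //.
  have := xP n nD; case: (k n) => // m; rewrite /halfspace /=.
  by rewrite -[in x + v](scale1r v) Qform_line (Qform_Fv00 _ vF) mulr0 addr0.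
Qed.

Lemma exists_natr_gt (c : R) : exists2 m : nat, c < m%:R & 0 <= m%:R :> R.
Proof.
exists (Num.truncn `|c|).+1; rewrite ?ler0n//.
by apply: le_lt_trans (ler_norm c) _; exact: truncnS_gt.
Qed.

(* The enclosures lose nothing here, because the simple roots lie in Delta: the
   germ of this chimney is the sector-germ. *)
Lemma chimney_germ_deep x (E : set AA) :
  chimney_germ g (lface g x F00) Cvf E <-> exists c, forall a, deep c a -> E a.
Proof.
split=> [[u _ [k [/= [E1 E1x E1P] PE]]]|[c cE]].
  have xuE : E1 (x + u) by exact: lface_point E1x.
  have [c cP] := shift_Cvf (x + u); exists c => _ /cP[v vC <-].
  by apply: PE; apply: E1P; exists (x + u) => //; exists v.
(* Integral levels are required: [m] exceeds c, and [p] exceeds m + b, where b bounds the simple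
   roots at x, so that x + p rho lies where all simple roots are at least m. *)
have [m cm m0] := exists_natr_gt c.
have [b b0 xb] := bound_simple_roots x.
have [p bp p0] := exists_natr_gt (m%:R + b).
(* Only the simple roots impose a condition; all other roots get the level +oo. *)
pose k (q : int) (n : {ffun I -> int}) : option int :=
  if `[< exists i, n = indic i >] then Some q else None.
have kP q a : (\bigcap_(n in Delta g) halfspace (@Qform R V n) (k q n)) a <->
    forall i, 0 <= alpha i a + q%:~R.
  split=> [aP i|aP n nD]; last first.
    rewrite /k; case: asboolP => // -[i ->]; rewrite /halfspace /= Qform_indic.
    exact: aP.
  have := aP _ (Delta_indic i); rewrite /k; case: asboolP => [_|[]]; last by exists i.
  by rewrite /halfspace /= Qform_indic.
exists (p%:R *: rho R V).
  apply: closure_Cvf => i; rewrite simple_rootZ simple_root_rho mulr1//.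
exists (k (- m%:Z)) => /=; split; last first.
  move=> a /kP aP; apply: cE => i; have := aP i.
  rewrite mulrNz -pmulrn; lra.
exists [set a | forall i, m%:R <= alpha i a]; last first.
  move=> _ [a am [v vC <-]]; apply/kP => i.
  by have := am i; have := vC i; rewrite simple_rootD mulrNz -pmulrn; lra.
(* The level p - m is the level -m before translation by p rho. *)
exists (k (p%:Z - m%:Z)), (fun=> None), setT; split.
- exact: filterT.
- move=> a aP i; rewrite simple_root_shift.
  have /kP/(_ i) : (\bigcap_(n in Delta g)
      halfspace (@Qform R V n) (k (p%:Z - m%:Z) n)) a.
    by move=> n nD; have [] := aP n nD.
  by rewrite intrB -!pmulrn; lra.
- move=> _ [_ [v /Fv00P v0 <-]] n nD; split=> //; move: n nD; apply/kP => i.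
  rewrite simple_rootD v0 intrB -!pmulrn; have := xb i; rewrite ler_norml.
  by move=> /andP[? ?]; lra.
Qed.

End Roots.

(** * Retractions and distances *)

Section Building.
Variables (R : realType) (V : vectorial_data).
Variable g : kac_moody_algebra R[i] (@vd_C V).
Variables (T : Type) (M : masure_data R V T).
Hypothesis masureM : is_masure g M.
Hypothesis finW : is_building R V.
Variable N : AA R V -> R.
Hypothesis euclN : Wv_euclidean_norm N.
Local Notation I := (vd_I V).
Local Notation AA := (AA R V).
Local Notation alpha := (@simple_root R V).
Local Notation Wv := (@Wv R V).
Local Notation Wa := (@Wa R V).
Local Notation Cvf := (@Cvf R V).
Local Notation F00 := (@Fv0 R V [set: I]%SET).

(** Each vector is conjugate to a dominant one, so any two points are comparable and every direction
    is generic. *)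
Lemma tits_setT : @tits R V = setT.
Proof.
apply/seteqP; split=> // v _; have [w [J [Ww [u uJ <-]]]] := Wv_Fv0 finW euclN v.
exists w; split=> //; exists u => //; apply: closure_Cvf => i.
by have := uJ i; case: ifP => _ => [->|/ltW].
Qed.

(** * Weyl charts of apartments *)

Definition chart (A : set T) (f : AA -> T) : Prop := apt M A /\ isomw M A f.

(** The image under [f] of the sector-germ +oo of the model. *)
Definition sgerm (f : AA -> T) : set_system T :=
  [set E | exists c, forall a, deep c a -> E (f a)].

Definition agree (f f' : AA -> T) : Prop :=
  exists c, forall a, deep c a -> f a = f' a.

Lemma exists_chart A : apt M A -> exists f, chart A f.
Proof.
move=> aptA; have [f _ isoA] := ma1 masureM aptA; exists f; split=> //.
by rewrite isoA; exists id => //; apply: Wa_Wv; exact: Wv_id.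
Qed.

Lemma chart_comp A f w : chart A f -> Wa w -> chart A (f \o w).
Proof.
move=> [aptA fA] Ww; split=> //; move: fA; have [h _ ->] := ma1 masureM aptA.
by move=> [w' Ww' <-]; exists (w' \o w) => //; exact: Wa_comp.
Qed.

Lemma chart_diff A f f' : chart A f -> chart A f' -> exists2 w, Wa w & f' = f \o w.
Proof.
move=> [aptA fA] [_ f'A]; move: fA f'A; have [h _ ->] := ma1 masureM aptA.
move=> [w Ww <-] [w' Ww' <-]; have [v [Wv' wv _]] := Wa_inv Ww.
exists (v \o w'); first exact: Wa_comp.
by rewrite -[RHS]/(h \o ((w \o v) \o w')) wv.
Qed.

Lemma chart_inj A f : chart A f -> injective f.
Proof.
move=> [aptA fA]; move: fA; have [h [_ hI _] ->] := ma1 masureM aptA.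
move=> [w Ww <-] x y /= /hI E; have [v [_ _ vw]] := Wa_inv Ww.
rewrite -[x](congr1 (@^~ x) vw) -[y](congr1 (@^~ y) vw) /= E ?in_setT //.
Qed.

Lemma chart_range A f : chart A f -> range f = A.
Proof.
move=> [aptA fA]; move: fA; have [h [hA _ hS] ->] := ma1 masureM aptA.
move=> [w Ww <-]; have [v [_ wv _]] := Wa_inv Ww.
apply/seteqP; split=> [_ [x _ <-]|x /hS[y _ <-]]; first exact: hA.
by exists (v y) => //=; rewrite -[w (v y)]/((w \o v) y) wv.
Qed.

Lemma chartA A f a : chart A f -> A (f a).
Proof. by move=> /chart_range <-; exists a. Qed.

Lemma chart_onto A f x : chart A f -> A x -> exists a, f a = x.
Proof. by move=> /chart_range <- [a _ <-]; exists a. Qed.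

Lemma weyl_isom_chart A B f phi : chart A f -> apt M B -> weyl_isom M A B phi ->
  chart B (phi \o f).
Proof.
move=> [aptA fA] /exists_chart[h hB] /(_ f h fA hB.2)[w Ww ->].
exact: chart_comp.
Qed.

Lemma chart_isom_model A f : chart A f -> isom_model M A f.
Proof.
move=> fA h hA; have [w Ww ->] := @chart_diff A h f (conj fA.1 hA) fA.
by exists w => //; exact: Wa_WvA_AutA.
Qed.

(** * Faces and sector-germs in the form used by the axioms *)

Lemma vface_Fv0 J : vface (@Fv0 R V J).
Proof. by exists true, id, J; split; [exact: Wv_id|rewrite /sg /= image_id]. Qed.

Lemma Fv0_set0 : @Fv0 R V finset.set0 = Cvf.
Proof.
apply/seteqP; split=> v vC i; first by have := vC i; rewrite finset.inE.
by rewrite finset.inE; exact: vC.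
Qed.

Lemma vface_Cvf : vface Cvf.
Proof. by rewrite -Fv0_set0; exact: vface_Fv0. Qed.

Lemma generic_setT v : @generic R V v.
Proof. by left; rewrite tits_setT interiorT. Qed.

Lemma solid_building F Fv : solid g F Fv.
Proof. by apply: sub_finite_set finW => w []. Qed.

Lemma is_face_point x : is_face g (lface g x F00).
Proof. by exists x, F00; split=> //; exact: vface_Fv0. Qed.

(** Presents the sector-germ as the germ of a chimney, so that (MA3) and (MA4) apply to it. *)
Lemma sgermE f x :
  sgerm f = fmap f (chimney_germ g (lface g x F00) Cvf).
Proof.
apply/seteqP; split=> E; first by move=> cE; apply/chimney_germ_deep.
by move/chimney_germ_deep.
Qed.

Lemma sgerm_splayed A f : chart A f ->
  in_some_apt M (splayed_chimney_germ g) (sgerm f).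
Proof.
move=> [aptA fA]; exists A, f, (chimney_germ g (lface g 0 F00) Cvf).
split=> //; last exact: sgermE.
exists (lface g 0 F00), Cvf; split=> //; first exact: is_face_point.
  exact: vface_Cvf.
exists (rho R V); split; last exact: generic_setT.
by move=> i; rewrite simple_root_rho.
Qed.

Lemma sgerm_solid A f : chart A f ->
  in_some_apt M (solid_chimney_germ g) (sgerm f).
Proof.
move=> [aptA fA]; exists A, f, (chimney_germ g (lface g 0 F00) Cvf).
split=> //; last exact: sgermE.
exists (lface g 0 F00), Cvf; split=> //; first exact: is_face_point.
  exact: vface_Cvf.
exact: solid_building.
Qed.

Lemma agree_sgerm f f' : agree f f' -> sgerm f = sgerm f'.
Proof.
move=> [c ff']; have H h h' : (forall a, deep c a -> h a = h' a) ->
    sgerm h `<=` sgerm h'.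
  move=> hh' E [c' cE]; exists (Num.max c c') => a ca.
  rewrite -hh'; first by apply: cE => i; have := ca i; rewrite gt_max => /andP[].
  by move=> i; have := ca i; rewrite gt_max => /andP[].
by apply/seteqP; split; apply: H => // a /ff'.
Qed.

Lemma agree_refl f : agree f f.
Proof. by exists 0. Qed.

Lemma agree_range A f f0 : chart A f -> agree f f0 -> sgerm f0 A.
Proof. by move=> fA [c ff0]; exists c => a /ff0 <-; exact: chartA fA. Qed.

(** Composing the chart with w turns the chamber w.[Cvf] into the dominant one. *)
Lemma sface_sgerm A (f : AA -> T) x C : chart A f -> vchamber_of_sign true C ->
  exists2 f', chart A f' & fmap f (sface_germ x C) = sgerm f'.
Proof.
move=> fA [w [Ww ->]]; exists (f \o w); first by apply: chart_comp => //; exact: Wa_Wv.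
apply/seteqP; split=> E; first by move=> /(sface_germ_deep _ _ Ww).
by move=> cE; apply/(sface_germ_deep _ _ Ww).
Qed.

Lemma sector_germ_sgerm s : sector_germ_of_sign M true s ->
  exists A f, chart A f /\ s = sgerm f.
Proof.
move=> [A [f [F0 [aptA fA [x [C [CV ->]]] ->]]]].
have [f' f'A ->] := sface_sgerm x (conj aptA fA) CV.
by exists A, f'.
Qed.

(** * Charts agreeing near a sector-germ *)

Lemma exists_agree A0 f0 B : chart A0 f0 -> apt M B -> sgerm f0 B ->
  exists2 f, chart B f & agree f f0.
Proof.
move=> f0A aptB sB.
have sA : sgerm f0 A0 := agree_range f0A (agree_refl f0).
(* The sector-germ plays both roles in (MA4), as a splayed and as a solid chimney germ; the
   isomorphism obtained fixes it. *)
have pairs : MA3_pair g M (sgerm f0) (sgerm f0).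
  by split; [exact: sgerm_splayed f0A|right; exact: sgerm_solid f0A].
have [phi phiW [E [k [[E1 [c cE1] [E2 _ E12]] PE] phiE]]] :=
  ma4 masureM pairs f0A.1 aptB sA sA sB sB f0A.2.
exists (phi \o f0); first exact: weyl_isom_chart phiW.
exists c => a /cE1 aE1; apply: phiE; first exact: chartA f0A.
have : (E1 `|` E2) (f0 a) by left.
by rewrite E12 => -[b /PE bE <-].
Qed.

Lemma fixed_deep w c : Wa w -> (forall a, deep c a -> w a = a) -> w = id.
Proof.
move=> [v [q [Wv' _ ->]]] wE; have [L LE] := Wv_linear Wv'.
move: wE; rewrite LE => wE.
(* Any vector a is the difference of the deep vectors u + a and u, both fixed by the affine map. *)
have La a : exists2 u : AA, deep c u & L a = a.
  have [c' c'0 c'P] := deep_shift c a.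
  pose t := `|c| + c' + 1; pose u := t *: rho R V.
  have tE i : alpha i u = t by rewrite simple_rootZ simple_root_rho mulr1.
  have cu : deep c u by move=> i; rewrite tE /t; have := ler_norm c; lra.
  have c'u : deep c' u by move=> i; rewrite tE /t; have := normr_ge0 c; lra.
  exists u => //; have := wE (u + a) (c'P _ c'u).
  by rewrite linearD addrAC (wE _ cu) => /addrI.
have q0 : q = 0.
  have [u cu _] := La 0; have [_ _ uE] := La u; have := wE _ cu.
  by rewrite uE -[in RHS](addr0 u) => /addrI.
by apply/funext => a; have [_ _ aE] := La a; rewrite /= aE q0 addr0.
Qed.

(** A half-space containing a deep set contains a ray in each dominant direction v; were the form
    negative on v, it would tend to -oo along that ray. *)
Lemma nonneg_Qform n (k : int) (c : R) (v : AA) : (forall i, 0 <= alpha i v) ->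
  (forall a : AA, deep c a -> 0 <= Qform n a + k%:~R) -> 0 <= Qform n v.
Proof.
move=> v0 Qk; rewrite leNgt; apply/negP => Qv.
pose u := (`|c| + 1) *: rho R V.
pose q := Qform n u + k%:~R.
pose t := `|q / Qform n v| + 1.
have t0 : 0 <= t by rewrite addr_ge0.
have : 0 <= Qform n (u + t *: v) + k%:~R.
  apply: Qk => i; rewrite simple_rootD !simple_rootZ simple_root_rho mulr1.
  by have := mulr_ge0 t0 (v0 i); have := ler_norm c; lra.
rewrite Qform_line addrAC -/q leNgt => /negP; apply.
have : - q / Qform n v < t.
  by rewrite /t -normrN -mulNr (le_lt_trans (ler_norm _)) // ltrDl.
by rewrite ltr_ndivrMr // => qt; lra.
Qed.

(** By (MA4) an isomorphism fixes the enclosure of the sector-germ and of a face at the common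
    point. The sector-germ forces the change of charts to be the identity, and the enclosure
    contains a plus every dominant vector. *)
Lemma agree_unique A A' f0 f f' a a' : chart A f -> chart A' f' ->
  agree f f0 -> agree f' f0 -> f a = f' a' ->
  a = a' /\ forall v, (forall i, 0 <= alpha i v) -> f (a + v) = f' (a + v).
Proof.
move=> fA f'A ff0 f'f0 ff'.
have AA'F : lface g a F00 (f @^-1` (A `&` A')).
  apply: encl_principal.
  have [] := ma2 masureM (F := principal_filter a) fA.1 f'A.1 fA.2 => //.
    by apply: Or41; exists a.
  by apply/principal_filterP; rewrite /= /preimage /= ff'; exact: (chartA _ f'A).
have sA := agree_range fA ff0; have sA' := agree_range f'A f'f0.
have sE : sgerm f0 = sgerm f by exact/esym/agree_sgerm.
have pairs : MA3_pair g M (sgerm f0) (fmap f (lface g a F00)).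
  split; first by rewrite sE; exact: sgerm_splayed fA.
  left; exists A, f, (lface g a F00); split=> //; [exact: fA.1|exact: fA.2|].
  exact: is_face_point.
have FA : fmap f (lface g a F00) A by apply: lfaceS AA'F => x [].
have FA' : fmap f (lface g a F00) A' by apply: lfaceS AA'F => x [].
have [phi phiW [E [k [[E1 E1s [E2 E2F E12]] PE] phiE]]] :=
  ma4 masureM pairs fA.1 f'A.1 sA FA sA' FA' fA.2.
have [w Ww fw] := chart_diff f'A (weyl_isom_chart fA f'A.1 phiW).
have fixE b : E (f b) -> f b = f' (w b).
  move=> /(phiE _ (chartA b fA)) pE.
  by rewrite -pE -[LHS]/((phi \o f) b) fw.
set P := \bigcap_(n in _) _ in E12 PE.
have PE1 b : E1 (f b) -> P b.
  move=> bE; have : (E1 `|` E2) (f b) by left.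
  by rewrite E12 => -[b' Pb' /(chart_inj fA) <-].
have Pa : P a.
  have : (E1 `|` E2) (f a) by right; exact: lface_point E2F.
  by rewrite E12 => -[b' Pb' /(chart_inj fA) <-].
have [c cP] : exists c, forall b, deep c b -> P b.
  by move: E1s; rewrite sE => -[c cE1]; exists c => b /cE1 /PE1.
(* Both charts coincide with [f0] far in the sector, where [phi] is the identity too. *)
have w1 : w = id.
  case: ff0 f'f0 => c1 c1E [c2 c2E].
  pose c' := Num.max c (Num.max c1 c2).
  apply: (fixed_deep (c := c')) Ww _ => b bc.
  apply: (chart_inj f'A); rewrite -fixE; last first.
    by apply/PE/cP => i; have := bc i; rewrite !gt_max => /and3P[].
  rewrite c1E ?c2E // => i; have := bc i; rewrite !gt_max => /and3P[] //.
split; first by apply: (chart_inj f'A); rewrite -ff' fixE ?w1 //; exact: PE.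
(* Each half-space of the enclosure contains a and a deep set, hence is stable under dominant
   translations of a. *)
move=> v v0; rewrite fixE ?w1 //; apply: PE => n nD.
have := Pa n nD; have cPn b : deep c b -> halfspace (Qform n) (k n) b by move/cP/(_ n nD).
case: (k n) cPn => // m mP; rewrite /halfspace /= -[v]scale1r Qform_line mul1r.
by have := nonneg_Qform v0 mP; lra.
Qed.

(** * The retraction from a sector-germ, in coordinates *)

Definition coord f0 (x : T) (a : AA) : Prop :=
  exists A f, [/\ chart A f, agree f f0 & f a = x].

Lemma coord_unique f0 x a b : coord f0 x a -> coord f0 x b -> a = b.
Proof.
move=> [A [f [fA ff0 <-]]] [B [h [hB hf0 /esym E]]].
exact: (agree_unique fA hB ff0 hf0 E).1.
Qed.

(** (MA3) puts the sector-germ and the face at y in direction v in one apartment [B]; (MA2) for the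
    germ of ]y, y + v] then compares the charts of [A] and [B], whose difference is in W^a. *)
Lemma germ_chart A0 f0 A f y v : chart A0 f0 -> chart A f -> v != 0 :> AA ->
  exists B h w b e, [/\ chart B h, agree h f0, Wv w, 0 < e
    & forall t, 0 <= t <= e -> f (y + t *: v) = h (b + t *: w v)].
Proof.
move=> f0A fA v0.
have [wv [J [Wwv wvJ]]] := Wv_Fv0 finW euclN v.
have faceF : in_some_apt M (is_face g) (fmap f (lface g y (wv @` Fv0 J))).
  exists A, f, (lface g y (wv @` Fv0 J)); split=> //; [exact: fA.1|exact: fA.2|].
  by exists y, (wv @` Fv0 J); split=> //; exists true, wv, J.
have pairs : MA3_pair g M (sgerm f0) (fmap f (lface g y (wv @` Fv0 J))).
  by split; [exact: sgerm_splayed f0A|left].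
have [B [aptB sB FB]] := ma3 masureM pairs.
have [h hB hf0] := exists_agree f0A aptB sB.
pose y' := y + v.
have yy' : y' - y = v by rewrite /y' addrC addKr.
have [] := ma2 masureM (F := within (lopen_segment y y') (nbhs y)) fA.1 aptB fA.2.
- apply: Or42; exists y, y'; split=> //; last first.
    by left; rewrite /leA tits_setT.
  by move=> E; move: v0; rewrite -yy' -E subrr eqxx.
- have [k [k' [Om [yOm PB OmP]]]] := FB.
  apply: filterS yOm => z zOm [t /andP[t0 t1] tz]; apply: PB; apply: OmP; split=> //.
  exists (z - y); last by rewrite addrC subrK.
  rewrite -tz yy' addrC addKr.
  have [u uJ <-] := wvJ; have [L LE] := Wv_linear Wwv; exists (t *: u).
    move=> i; rewrite simple_rootZ; have := uJ i; case: ifP => _ => [->|a0].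
      by rewrite mulr0.
    by rewrite mulr_gt0.
  by rewrite LE linearZ.
move=> _ [phi phiW [E [k [PF PE]] phiE]].
have [w Ww fw] := chart_diff hB (weyl_isom_chart fA aptB phiW).
have [e e0 eP] := nbhs_line v PF.
set P := \bigcap_(n in _) _ in PF PE eP.
have eP' t : 0 < t <= Num.min e 1 -> P (y + t *: v).
  rewrite le_min => /and3P[t0 te t1]; apply: eP; first by rewrite ltW.
  by exists t; rewrite ?yy' //= t0.
pose e' := Num.min e 1.
have e'0 : 0 < e' by rewrite /e' lt_min e0 ltr01.
(* The set [P] is an intersection of closed half-spaces containing y + t v for small t > 0. With [s]
   bounding the slope, a negative value [q] at y would persist at the chosen t. *)
have Py : P y.
  move=> n nD; have := fun t te => eP' t te n nD; case: (k n) => // m mP.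
  rewrite /halfspace /= leNgt; apply/negP => q0; set q := _ + _ in q0.
  pose s := `|Qform n v| + 1; have s0 : 0 < s by rewrite /s ltr_pwDr.
  pose t := Num.min e' (- q / s / 2).
  have t0 : 0 < t by rewrite lt_min e'0 !divr_gt0 ?oppr_gt0.
  have ts : t * s <= - q / 2.
    rewrite -ler_pdivlMr //; apply: le_trans (_ : - q / s / 2 <= _).
      by rewrite /t ge_min lexx orbT.
    by rewrite mulrAC.
  have := mP t; rewrite t0 /t ge_min lexx => /(_ isT); rewrite /halfspace /= -/t.
  rewrite Qform_line addrAC -/q.
  have := ler_wpM2l (ltW t0) (ler_norm (Qform n v)).
  by move: ts; rewrite /s mulrDr mulr1; lra.
have [w' [q [Ww' _ wE]]] := Ww.
exists B, h, w', (w y), e'; split=> // t /andP[t0 te].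
have {}eP' : P (y + t *: v).
  move: t0; rewrite le_eqVlt => /predU1P[<-|t0]; first by rewrite scale0r addr0.
  by apply: eP'; rewrite t0.
have := phiE _ (chartA (y + t *: v) fA) (PE _ eP') => <-.
rewrite -[LHS]/((phi \o f) _) fw /=; congr h.
by rewrite wE; have [L ->] := Wv_linear Ww'; rewrite linearD linearZ addrAC.
Qed.

Lemma coord_total A0 f0 x : chart A0 f0 -> exists a, coord f0 x a.
Proof.
move=> f0A; have [A aptA Ax] := ma_cover masureM x.
have [f fA] := exists_chart aptA.
have [a fa] := chart_onto fA Ax.
have pairs : MA3_pair g M (sgerm f0) (fmap f (lface g a F00)).
  split; first by exact: sgerm_splayed f0A.
  left; exists A, f, (lface g a F00); split=> //; [exact: fA.2|].
  exact: is_face_point.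
have [B [aptB sB FB]] := ma3 masureM pairs.
have [h hB hf0] := exists_agree f0A aptB sB.
have := chart_onto hB (lface_point FB); rewrite fa => -[b hb].
by exists b, B, h.
Qed.

Lemma closure_Fv00 (u : AA) : closure F00 u -> F00 u.
Proof.
move=> uF i; rewrite inE /=.
have cont : continuous (fun v : AA => alpha i v).
  apply: continuous_big => [|k _ v]; first exact: add_continuous.
  by apply: continuousM; [exact: cst_continuous|exact: coord_continuous].
have cl : closed [set v : AA | alpha i v = 0].
  by move/continuous_closedP: cont => /(_ [set 0]); apply; exact: closed_eq.
by apply: (cl u); apply: closureS uF => v /Fv00P/(_ i).
Qed.

(* When W^v is finite, the vectorial face F00 is spherical, so that (MA3) applies
   to the chimney germ based at a point. *)
Lemma common_chart x x' : exists A f a a', [/\ chart A f, f a = x & f a' = x'].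
Proof.
have [A aptA Ax] := ma_cover masureM x; have [A' aptA' Ax'] := ma_cover masureM x'.
have [f fA] := exists_chart aptA; have [a fa] := chart_onto fA Ax.
have [f' f'A] := exists_chart aptA'; have [a' fa'] := chart_onto f'A Ax'.
pose F := chimney_germ g (lface g a F00) F00.
have pairs : MA3_pair g M (fmap f F) (fmap f' (lface g a' F00)).
  split.
    exists A, f, F; split=> //; first exact: fA.2.
    exists (lface g a F00), F00; split=> //; [exact: is_face_point|exact: vface_Fv0|].
    by exists 0; split; [exact: Fv00_0|exact: generic_setT _].
  left; exists A', f', (lface g a' F00); split=> //; [exact: f'A.2|].
  exact: is_face_point.
have [B [aptB RB FB]] := ma3 masureM pairs.
have [h hB] := exists_chart aptB.
have [b' hb'] := chart_onto hB (lface_point FB).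
(* Translating by a vector u of the closure of [F00] changes no root, so the enclosure around a + u
   contains a. *)
have Ba : B (f a).
  have [u uF [k [[E1 E1a E1P] PB]]] := RB.
  have Qu n : Qform n (a + u) = Qform n a.
    by rewrite -[u]scale1r Qform_line (Qform_Fv00 _ (closure_Fv00 uF)) mulr0 addr0.
  apply: PB => n nD; have := E1P (a + u) _ n nD.
  case: (k n) => // m; rewrite /halfspace /= Qu; apply.
  exists (a + u); first exact: lface_point E1a.
  by exists 0; [exact: Fv00_0|rewrite addr0].
have [b hb] := chart_onto hB Ba.
by exists B, h, b, b'; split; rewrite ?hb ?hb'.
Qed.

(** * Contraction of segments and the distance of the building *)

Lemma N_norm : is_norm N.
Proof. exact: euclidean_is_norm euclN. Qed.

Lemma N_Wv w u : Wv w -> N (w u) = N u.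
Proof. by move=> Ww; have [B [_ _ _ Binv NE]] := euclN; rewrite !NE Binv. Qed.

(* Both germs of a segment at each of its points lie in an apartment which
   contains the sector-germ, so that compactness cuts the segment into pieces
   along which the relation P can be checked in one chart. *)
Lemma segment_induction A0 f0 A f a v (P : T -> R -> Prop) :
  chart A0 f0 -> chart A f -> P (f a) 0 ->
  (forall B h b w t t', chart B h -> agree h f0 -> N w = N v -> t <= t' ->
     P (h b) t -> P (h (b + (t' - t) *: w)) t') ->
  P (f (a + v)) 1.
Proof.
move=> f0A fA P0 step; have [v0|v0] := eqVneq v 0.
  (* A constant segment has no direction: one step of length zero leads from time 0 to time 1. *)
  have [b [B [h [hB hf0 hb]]]] := coord_total (f a) f0A.
  rewrite v0 addr0 -hb -[b]addr0 -(scaler0 _ (1 - 0)).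
  by apply: (step B) => //; rewrite ?hb ?v0 ?norm0 //; exact: N_norm.
have Nv w : Wv w -> N (w v) = N v /\ N (w (- v)) = N v.
  by move=> Ww; rewrite !(N_Wv _ Ww) (normN _ N_norm).
rewrite -[v]scale1r; pose Q t := P (f (a + t *: v)) t.
apply: (@interval_induction _ Q) => [|t _]; first by rewrite /Q scale0r addr0.
have [B [h [w [b [e [hB hf0 Ww e0 fh]]]]]] := germ_chart (a + t *: v) f0A fA v0.
(* The germ arriving at the point is handled as the one leaving it in direction -v. *)
have [B' [h' [w' [b' [e' [hB' hf0' Ww' e'0 fh']]]]]] :
  exists B h w b e, [/\ chart B h, agree h f0, Wv w, 0 < e
    & forall s, 0 <= s <= e -> f (a + t *: v + s *: - v) = h (b + s *: w (- v))].
  by apply: germ_chart f0A fA _; rewrite oppr_eq0.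
exists (Num.min e e'); first by rewrite lt_min e0.
have le_e : Num.min e e' <= e by rewrite ge_min lexx.
have le_e' : Num.min e e' <= e' by rewrite ge_min lexx orbT.
move=> s _; split=> /andP[s1 s2]; rewrite /Q.
  have -> : a + s *: v = a + t *: v + (t - s) *: - v.
    by rewrite scalerN -addrA -scalerBl; congr (_ + _ *: _); ring.
  rewrite fh'; last by apply/andP; split; lra.
  have -> : a + t *: v = a + t *: v + 0 *: - v by rewrite scale0r addr0.
  rewrite fh'; last by rewrite lexx ltW.
  have -> : b' + 0 *: w' (- v) =
      b' + (t - s) *: w' (- v) + (t - s) *: - w' (- v).
    by rewrite scalerN addrK scale0r addr0.
  apply: (step B') => //; rewrite (normN _ N_norm).
  by have [_ ->] := Nv _ Ww'.
have -> : a + s *: v = a + t *: v + (s - t) *: v.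
  by rewrite -addrA -scalerDl; congr (_ + _ *: _); ring.
rewrite fh; last by apply/andP; split; lra.
have -> : a + t *: v = a + t *: v + 0 *: v by rewrite scale0r addr0.
rewrite fh; last by rewrite lexx ltW.
rewrite scale0r addr0; apply: (step B) => //; exact: (Nv _ Ww).1.
Qed.

(** On each piece the retraction is read in a single chart, where it moves by (t' - t) times a
    vector of norm N v; the triangle inequality adds up the pieces. *)
Lemma coord_contract A0 f0 A f a a' b b' : chart A0 f0 -> chart A f ->
  coord f0 (f a) b -> coord f0 (f a') b' -> N (b' - b) <= N (a' - a).
Proof.
move=> f0A fA fab; pose v := a' - a; have -> : a' = a + v by rewrite addrC subrK.
have -> : a + v - a = v by rewrite addrC addKr.
move=> fab'; rewrite -[leRHS]mul1r.
pose P x t := forall c, coord f0 x c -> N (c - b) <= t * N v.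
apply: (segment_induction (P := P) f0A fA) fab' => [c fac|].
  by rewrite (coord_unique fab fac) subrr (norm0 N_norm) mul0r.
move=> B h d w t t' hB hf0 Nw tt' IH c hc.
have hd x : coord f0 (h x) x by exists B, h.
rewrite -(coord_unique (hd _) hc); have := IH _ (hd d).
have := norm_triangle N_norm ((t' - t) *: w) (d - b).
rewrite addrA [_ + d]addrC (norm_homog N_norm) ger0_norm ?subr_ge0 // Nw.
by rewrite mulrBl; lra.
Qed.

(** Each chart serves in turn as the target of a retraction, which fixes the points of its own
    apartment, and the contraction is used both ways. *)
Lemma chart_isometry A f A' f' a a' b b' : chart A f -> chart A' f' ->
  f a = f' b -> f a' = f' b' -> N (a' - a) = N (b' - b).
Proof.
move=> fA f'A fab fab'.
have coordE B h c : chart B h -> coord h (h c) c.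
  by move=> hB; exists B, h; split=> //; exact: agree_refl.
apply/eqP; rewrite eq_le; apply/andP; split.
  by apply: (coord_contract fA f'A); rewrite -?fab -?fab'; exact: coordE fA.
by apply: (coord_contract f'A fA); rewrite ?fab ?fab'; exact: coordE f'A.
Qed.

Lemma isom_model_chart A psi : apt M A -> isom_model M A psi ->
  exists f w, [/\ chart A f, psi = f \o w
    & forall a a', N (w a' - w a) = N (a' - a)].
Proof.
move=> aptA psiA; have [f fA] := exists_chart aptA.
have [w [[v [q [Wv' _ wE]]] _] psiE] := psiA f fA.2.
exists f, w; split=> // a a'; rewrite wE opprD addrACA subrr addr0.
have [L LE] := Wv_linear Wv'; rewrite LE -linearB -LE; exact: N_Wv.
Qed.

Lemma building_dist_isom A psi a a' : apt M A -> isom_model M A psi ->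
  building_dist M N (psi a) (psi a') = N (a' - a).
Proof.
move=> aptA psiA; rewrite /building_dist; apply: get_unique.
  by exists A, psi, a, a'.
move=> _ [B [h [b [b' [aptB hB hb hb' ->]]]]].
have [f [w [fA fE fN]]] := isom_model_chart aptA psiA.
have [f' [w' [f'B f'E f'N]]] := isom_model_chart aptB hB.
move: hb hb'; rewrite fE f'E /= => hb hb'.
by rewrite -(fN a a') -(f'N b b'); exact: (chart_isometry f'B fA hb hb').
Qed.

Lemma building_dist_chart A f a a' : chart A f ->
  building_dist M N (f a) (f a') = N (a' - a).
Proof.
by move=> fA; apply: (building_dist_isom _ _ fA.1); exact: chart_isom_model.
Qed.

Lemma building_distC x y : building_dist M N x y = building_dist M N y x.
Proof.
have [A [f [a [a' [fA <- <-]]]]] := common_chart x y.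
by rewrite !(building_dist_chart _ _ fA) -(normN _ N_norm) opprB.
Qed.

(** Retract y onto an apartment containing x and z: these two points are fixed and no distance
    increases. *)
Lemma building_dist_triangle x y z :
  building_dist M N x z <= building_dist M N x y + building_dist M N y z.
Proof.
have [A [f [a [c [fA fa fc]]]]] := common_chart x z.
have [b yb] := coord_total y fA.
have coordE d : coord f (f d) d.
  by exists A, f; split=> //; exact: agree_refl.
have le_dist u v du dv : coord f u du -> coord f v dv ->
    N (dv - du) <= building_dist M N u v.
  have [B [h [d [d' [hB <- <-]]]]] := common_chart u v.
  rewrite (building_dist_chart _ _ hB); exact: coord_contract fA hB.
have xa : coord f x a by rewrite -fa.
have zc : coord f z c by rewrite -fc.
rewrite -{1}fa -{1}fc (building_dist_chart _ _ fA).
apply: le_trans (lerD (le_dist _ _ _ _ xa yb) (le_dist _ _ _ _ yb zc)).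
have -> : c - a = (b - a) + (c - b) by rewrite [RHS]addrC addrA subrK.
exact: norm_triangle N_norm _ _.
Qed.

(** * Translations towards the sector-germ and upper bounds for d_theta *)

Section Reach.
Variables (A0 : set T) (f0 : AA -> T) (f0A : chart A0 f0).
Variables (nm : AA -> R) (nmP : is_norm nm).

Definition dplus (x : T) (u : AA) (z : T) : Prop :=
  exists A f a, [/\ chart A f, agree f f0, f a = x & z = f (a + u)].

(** An explicit pair bounding d_theta by c. Such bounds add up along a path without recourse to the
    infimum. *)
Definition reach (x y : T) (c : R) : Prop :=
  exists u u' z, [/\ forall i, 0 <= alpha i u, forall i, 0 <= alpha i u',
    dplus x u z, dplus y u' z & nm u + nm u' <= c].

(** By [agree_unique] the second, dominant translation can be carried out in the chart of the
    first. *)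
Lemma dplusD x u v y z : (forall i, 0 <= alpha i v) ->
  dplus x u y -> dplus y v z -> dplus x (u + v) z.
Proof.
move=> v0 [A [f [a [fA ff0 fa ->]]]] [B [h [b [hB hf0 hb ->]]]].
exists A, f, a; split=> //.
have [bE hE] := agree_unique hB fA hf0 ff0 hb.
by rewrite hE // bE addrA.
Qed.

Lemma dplus_total x u : exists z, dplus x u z.
Proof.
have [a [A [f [fA ff0 fa]]]] := coord_total x f0A.
by exists (f (a + u)), A, f, a.
Qed.

Lemma dplus_unique x u z z' : (forall i, 0 <= alpha i u) ->
  dplus x u z -> dplus x u z' -> z = z'.
Proof.
move=> u0 [A [f [a [fA ff0 fa ->]]]] [B [h [b [hB hf0 hb ->]]]].
have [<- fE] := agree_unique fA hB ff0 hf0 (etrans fa (esym hb)).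
exact: fE.
Qed.

(** With p = x + u = y + u' and q = y + v = z + v', the points p + v and q + u' both equal y + u' +
    v. Hence x + (u + v) = z + (v' + u'). *)
Lemma reach_trans x y z c d : reach x y c -> reach y z d -> reach x z (c + d).
Proof.
move=> [u [u' [p [u0 u'0 xp yp uc]]]] [v [v' [q [v0 v'0 yq zq vd]]]].
have [s ps] := dplus_total p v; have [s' qs'] := dplus_total q u'.
have s's : s' = s.
  apply: (dplus_unique (x := y) (u := u' + v)).
  - by move=> i; rewrite simple_rootD addr_ge0.
  - by rewrite addrC; exact: dplusD yq qs'.
  - exact: dplusD yp ps.
rewrite s's in qs'; exists (u + v), (v' + u'), s; split.
- by move=> i; rewrite simple_rootD addr_ge0.
- by move=> i; rewrite simple_rootD addr_ge0.
- exact: dplusD xp ps.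
- exact: dplusD zq qs'.
- have := norm_triangle nmP u v; have := norm_triangle nmP v' u'; lra.
Qed.

Lemma reach_Uset s x y c : s = sgerm f0 -> reach x y c ->
  exists2 p, Uset M true s x y p & nm p.1 + nm p.2 <= c.
Proof.
move=> sE [u [u' [z [u0 u'0 xz yz uc]]]].
have splusE x' v : dplus x' v z -> splus M true s x' v z.
  move=> [A [f [a [fA ff0 fa ->]]]]; exists A, f, a; split=> //.
    split; [exact: fA.1| |]; first by rewrite -fa; exact: chartA fA.
    by rewrite sE; exact: agree_range fA ff0.
  - exact: chart_isom_model.
  - rewrite sE -(agree_sgerm ff0) /sg /= image_id -[Cvf]image_id.
    apply/seteqP; split=> E; first by move=> /(sface_germ_deep _ _ (@Wv_id R V)).
    by move=> cE; apply/(sface_germ_deep _ _ (@Wv_id R V)).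
exists (u, u') => //; split=> /=; [exact: closure_Cvf|exact: closure_Cvf|].
by exists z; split; exact: splusE.
Qed.

Lemma exists_reach_bound : exists2 L : R, 0 < L &
  forall x y, reach x y (L * building_dist M N x y).
Proof.
have [K K0 Kb] := simple_roots_bounded N_norm.
have [C C0 nmC] := norm_equiv nmP N_norm.
(* Inside one chart, u' = (K N v) rho makes v + u' dominant, and nm (v + u') + nm u' is at most C N
   v + 2 K N v nm(rho). *)
pose r := rho R V; pose L := C + 2 * K * nm r.
have r0 : 0 <= nm r by exact: norm_ge0.
have L0 : 0 < L by rewrite ltr_pwDl // !mulr_ge0 // ltW.
have local B h b v : chart B h -> agree h f0 -> reach (h b) (h (b + v)) (L * N v).
  move=> hB hf0; have Nv0 : 0 <= N v by apply: norm_ge0; exact: N_norm.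
  have KN : 0 <= K * N v by rewrite mulr_ge0 // ltW.
  pose u' := (K * N v) *: r.
  have u'i i : alpha i u' = K * N v.
    by rewrite simple_rootZ simple_root_rho mulr1.
  exists (v + u'), u', (h (b + v + u')); split.
  - move=> i; rewrite simple_rootD u'i; have := Kb i v; rewrite ler_norml.
    by move=> /andP[? _]; lra.
  - by move=> i; rewrite u'i.
  - by exists B, h, b; split=> //; rewrite addrA.
  - by exists B, h, (b + v).
  - have := norm_triangle nmP v u'; have := nmC v.
    rewrite /u' (norm_homog nmP) ger0_norm // /L; lra.
exists L => // x y; have [A [f [a [a' [fA <- <-]]]]] := common_chart x y.
rewrite (building_dist_chart _ _ fA); pose v := a' - a.
have -> : a' = a + v by rewrite addrC subrK.
have -> : a + v - a = v by rewrite addrC addKr.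
rewrite -[X in reach _ _ X]mul1r.
pose P z t := reach (f a) z (t * (L * N v)).
apply: (segment_induction (P := P) f0A fA).
  have [b [B [h [hB hf0 hb]]]] := coord_total (f a) f0A.
  have := local _ _ b 0 hB hf0.
  by rewrite addr0 hb (norm0 N_norm) /P mulr0 mul0r.
move=> B h b w t t' hB hf0 Nw tt'; rewrite /P => IH.
have := reach_trans IH (local _ _ b ((t' - t) *: w) hB hf0).
rewrite (norm_homog N_norm) Nw ger0_norm ?subr_ge0 //.
by have -> : t * (L * N v) + L * ((t' - t) * N v) = t' * (L * N v) by ring.
Qed.

End Reach.

Lemma splus_dist s x u z : splus M true s x u z -> building_dist M N x z = N u.
Proof.
move=> [A [psi [a [[aptA _ _] psiA _ <- ->]]]].
by rewrite (building_dist_isom _ _ aptA psiA) addrC addKr.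
Qed.

Lemma building_equiv (theta : (AA -> R) * set_system T) : Theta M true theta ->
  exists k l : R, [/\ 0 < k, 0 < l &
    forall x x' : T,
      k * building_dist M N x x' <= dtheta M true theta x x' /\
      dtheta M true theta x x' <= l * building_dist M N x x'].
Proof.
case: theta => nm s [/= nmP /sector_germ_sgerm[A0 [f0 [f0A sE]]]].
have [l l0 lreach] := exists_reach_bound f0A nmP.
have [C C0 NC] := norm_equiv N_norm nmP.
exists C^-1, l; rewrite invr_gt0; split=> // x x'.
have [p pU pl] := reach_Uset sE (lreach x x').
(* For the upper bound, the pair [p] supplied by [reach] competes in the infimum. *)
split; last first.
  apply: le_trans pl; apply: ge_inf; last by exists p.
  by exists 0 => _ [q _ <-] /=; rewrite addr_ge0 // norm_ge0.
apply: lb_le_inf; first by exists (nm p.1 + nm p.2), p.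
(* For the lower bound, any competing pair gives a path through z whose length for the building
   distance is N u + N u'. *)
move=> _ [[u u'] [_ _ [z [xz x'z]]] <-] /=; rewrite ler_pdivrMl //.
apply: le_trans (building_dist_triangle x z x') _.
rewrite (splus_dist xz) building_distC (splus_dist x'z) mulrDr.
exact: lerD.
Qed.

End Building.

Theorem proposition42 (R : realType) (V : vectorial_data)
  (g : kac_moody_algebra R[i] (@vd_C V))
  (T : Type) (M : masure_data R V T)
  (masureM : is_masure g M)
  (panelsM : panels_ok g M)
  (G : groupType) (act : G -> T -> T)
  (actM : strongly_transitive g M act)
  (f0 : AA R V -> T) (stabM : stabilizer_induces_WvY M act f0)
  (buildingM : is_building R V)
  (N : AA R V -> R) (euclN : Wv_euclidean_norm N)
  (theta : (AA R V -> R) * set_system T) (thetaP : Theta M true theta) :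
  exists k l : R, [/\ 0 < k, 0 < l &
    forall x x' : T,
      k * building_dist M N x x' <= dtheta M true theta x x' /\
      dtheta M true theta x x' <= l * building_dist M N x x'].
Proof.
exact (building_equiv masureM buildingM euclN thetaP).
Qed.
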